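(* Let $\Omega$, $B$, $B^+$, $Z$, $B_Z$, $U_Z$, $C_Z$, $\mathcal{P}_Z$, $G$, $A$, $\phi$ and $\phi^*$ be as in the context. Assume (C) for every $n\in\mathbb{N}$ there exists $z\in\mathbb{R}_+$ such that $n(Z-z)^+-\frac1n\in G-A$. Then the following three conditions are equivalent: (i) there exist no $X\in G-A$ and $\varepsilon\in(0,\infty)$ such that $X\ge\varepsilon$; (ii) there exists $\mathbb{P}\in\mathcal{P}_Z$ such that $\mathbb{E}^{\mathbb{P}}X\le 0$ for all $X\in C_Z\cap(G-A)$; (iii) $\phi$ is real-valued on $B_Z$, $\phi(0)=0$, and $\phi(X)=\max_{\mathbb{P}\in\mathcal{P}_Z}(\mathbb{E}^{\mathbb{P}}X-\phi^*(\mathbb{P}))$ for all $X\in C_Z$ (the supremum being attained). If in addition to (C) one has (U) $\phi(X)=\inf_{Y\in C_Z,\,Y\ge X}\phi(Y)$ for all $X\in U_Z$, then (i)–(iii) are also equivalent to each of the following: (iv) there exists no $X\in G-A$ with $X(\omega)>0$ for all $\omega\in\Omega$; (v) there exists $\mathbb{P}\in\mathcal{P}_Z$ such that $\mathbb{E}^{\mathbb{P}}X\le0$ for all $X\in U_Z\cap(G-A)$; (vi) $\phi$ is real-valued on $B_Z$, $\phi(0)=0$, and $\phi(X)=\max_{\mathbb{P}\in\mathcal{P}_Z}(\mathbb{E}^{\mathbb{P}}X-\phi^*(\mathbb{P}))$ for all $X\in U_Z$.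
   Context: Fix integers $J\ge0$, $T\ge1$. $\Omega$ is a non-empty subset of $((0,\infty)\times\mathbb{R}^J)^T$, endowed with the Euclidean metric. $B$ is the space of all Borel measurable functions $X:\Omega\to\mathbb{R}$ and $B^+=\{X\in B:X\ge0\}$. $Z:\Omega\to[1,\infty)$ is a continuous function such that $\{\omega\in\Omega:Z(\omega)\le z\}$ is compact for every $z\in\mathbb{R}_+$. $B_Z$ is the set of $X\in B$ with $X/Z$ bounded, $U_Z$ the set of upper semicontinuous $X\in B_Z$, $C_Z$ the set of continuous $X\in B_Z$, and $\mathcal{P}_Z$ the set of Borel probability measures $\mathbb{P}$ on $\Omega$ with $\mathbb{E}^{\mathbb{P}}Z<\infty$. $G\subseteq B$ is a set with $0\in G$; $A\subseteq B$ is a set with $B^+\subseteq A$, $A+B^+\subseteq A$, and $A-G=\{a-g:a\in A,g\in G\}$ convex ($G-A$ is defined analogously). For $X\in B$, $\phi(X)=\inf\{m\in\mathbb{R}:m-X\in A-G\}$ with $\inf\emptyset=+\infty$. For $\mathbb{P}\in\mathcal{P}_Z$, $\phi^*(\mathbb{P})=\sup_{X\in C_Z}(\mathbb{E}^{\mathbb{P}}X-\phi(X))$. *)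

(* Defs.v *)
(* R : realType, Omega = a subset of the matrix
   space 'M[R]_(T, J.+1) (row t = the t-th copy of (0,oo) x R^J, column 0 =
   the (0,oo)-coordinate), with the subspace topology and its Borel sigma-algebra. *)
From HB Require Import structures.
From mathcomp Require Import all_boot all_order all_algebra.
From mathcomp Require Import all_classical all_reals all_analysis.
Set Implicit Arguments. Unset Strict Implicit. Unset Printing Implicit Defensive.
Import Order.TTheory GRing.Theory Num.Theory.
Import numFieldNormedType.Exports.
Local Open Scope classical_set_scope.
Local Open Scope ring_scope.

Section OmegaSpace.
Variables (R : realType) (T J : nat) (Om : set 'M[R]_(T, J.+1)).

Definition OmT (x0 : set_type Om) := set_type Om.
Variable x0 : set_type Om.
HB.instance Definition _ := Topological.on (OmT x0).
HB.instance Definition _ := isPointed.Build (OmT x0) x0.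

Definition OmM := g_sigma_algebraType (@open (OmT x0)).

Definition Borel (X : OmT x0 -> R) : Prop := measurable_fun [set: OmM] (X : OmM -> R).

Definition Ex (P : probability OmM R) (X : OmT x0 -> R) : \bar R :=
  (\int[P]_w (X w)%:E)%E.

Definition usc (X : OmT x0 -> R) : Prop :=
  forall w a, X w < a -> \forall y \near w, X y < a.

Variable Z : OmT x0 -> R.

Definition BZ : set (OmT x0 -> R) :=
  [set X | Borel X /\ exists c : R, forall w, `|X w / Z w| <= c].
Definition UZ : set (OmT x0 -> R) := [set X | BZ X /\ usc X].
Definition CZ : set (OmT x0 -> R) := [set X | BZ X /\ continuous X].
Definition PZ : set (probability OmM R) :=
  fun P : probability OmM R => (\int[P]_(w in [set: OmM]) (Z w)%:E < +oo)%E.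

Variables (A G : set (OmT x0 -> R)).

Definition AmG : set (OmT x0 -> R) := [set X | exists a g, A a /\ G g /\ X = a \- g].
Definition GmA : set (OmT x0 -> R) := [set X | exists g a, G g /\ A a /\ X = g \- a].

Definition phi (X : OmT x0 -> R) : \bar R :=
  ereal_inf [set m%:E | m in [set m : R | AmG (fun w => m - X w)]].

Definition phistar (P : probability OmM R) : \bar R :=
  ereal_sup [set (Ex P X - phi X)%E | X in CZ].

Definition dual_rep (X : OmT x0 -> R) : Prop :=
  phi X = ereal_sup [set (Ex P X - phistar P)%E | P in PZ] /\
  exists2 P0, PZ P0 & phi X = (Ex P0 X - phistar P0)%E.

End OmegaSpace.

(* Main.v *)
(* Idea. The price [phi] is convex, monotone and translation invariant, and
   condition (C) makes it finite on [B_Z] once no constant [m < 0] lies in [A - G],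
   which is what (i) says. For [X] upper semicontinuous in [B_Z], Hahn-Banach gives
   a linear subgradient [l] of [phi] at [X] on all of [B_Z]; it is positive with
   [l 1 = 1], (C) and convexity make [l ((Z - z)^+)] small for large [z], and
   Dini's lemma on the compact sets [Z <= z] turns this into Daniell continuity.
   Hence [l] is integration against some [P] in [P_Z] on continuous functions, and
   [l X <= E^P X] because [X] is a decreasing limit of such functions. So [P] attains
   the dual value at [X] simultaneously in (iii) and (vi); (U) only serves the
   inequality [E^P X - phi^* P <= phi X]. From (v) to (iv), closed inner regularity
   puts a multiple of the indicator of a closed set below a positive [X] in [G - A]. *)
Require Import Defs.
From HB Require Import structures.
From mathcomp Require Import all_boot all_order all_algebra.
From mathcomp Require Import all_classical all_reals all_analysis.
From mathcomp Require Import measurable_realfun.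
From mathcomp Require Import lra ring.
Set Implicit Arguments. Unset Strict Implicit. Unset Printing Implicit Defensive.
Import Order.TTheory GRing.Theory Num.Theory.
Import numFieldNormedType.Exports.
Local Open Scope classical_set_scope.
Local Open Scope ring_scope.

(** * Dominated extension *)

Section HahnBanach.
Variables (R : realType) (V : lmodType R) (D : set V) (p : V -> R).
Hypothesis D0 : D 0.
Hypothesis Dlin : forall a x y, D x -> D y -> D (a *: x + y).
Hypothesis p_convex : forall x y (t : R), D x -> D y -> 0 <= t <= 1 ->
  p (t *: x + (1 - t) *: y) <= t * p x + (1 - t) * p y.
Hypothesis p0 : 0 <= p 0.

(* Partial linear functionals on [D] dominated by [p] are encoded by their
   graphs; a linear relation lying below [p] is automatically single-valued. *)
Definition dominated_graph (A : set (V * R)) : Prop :=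
  (forall a x y, A x -> A y -> A (a *: x.1 + y.1, a * x.2 + y.2)) /\
  (forall x, A x -> D x.1 /\ x.2 <= p x.1).

(** Giving weight [t / (s + t)] to [x.1 - s *: v] and the rest to [y.1 + t *: v] cancels [v]. The
    combination lies in the domain of the graph, where domination applies, and convexity of [p]
    splits the bound. *)
Lemma extension_gap (A : set (V * R)) (v : V) : dominated_graph A -> D v ->
  forall x y s t, A x -> A y -> 0 < s -> 0 < t ->
  (x.2 - p (x.1 - s *: v)) / s <= (p (y.1 + t *: v) - y.2) / t.
Proof.
move=> [Alin Ap] Dv x y s t Ax Ay s0 t0.
have st0 : 0 < s + t by rewrite addr_gt0.
have Dm : D (x.1 - s *: v).
  by rewrite -scaleNr addrC; apply: Dlin => //; case: (Ap _ Ax).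
have Dp : D (y.1 + t *: v) by rewrite addrC; apply: Dlin => //; case: (Ap _ Ay).
pose l := t / (s + t).
have l01 : 0 <= l <= 1.
  by rewrite /l divr_ge0 ?(ltW t0) ?(ltW st0)//= ler_pdivrMr// mul1r lerDr ltW.
have l1 : 1 - l = s / (s + t) by rewrite /l; field; rewrite gt_eqF.
have A00 : A (0, 0).
  have := Alin (-1) _ _ Ax Ax.
  by rewrite scaleN1r addNr mulN1r addNr.
have Al : A (l *: x.1 + (1 - l) *: y.1, l * x.2 + (1 - l) * y.2).
  have h := Alin (1 - l) _ _ Ay A00; rewrite /= !addr0 in h.
  exact: (Alin l _ _ Ax h).
have := (Ap _ Al).2 => /=.
have -> : l *: x.1 + (1 - l) *: y.1 =
    l *: (x.1 - s *: v) + (1 - l) *: (y.1 + t *: v).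
  rewrite !scalerDr scalerN !scalerA [RHS]addrACA.
  suff -> : (1 - l) * t = l * s by rewrite addNr addr0.
  by rewrite l1 /l mulrAC [RHS]mulrAC mulrC [t * s]mulrC mulrC.
move=> /le_trans /(_ (p_convex Dm Dp l01)).
rewrite l1 /l ![_ / (s + t) * _]mulrAC -!mulrDl ler_pM2r ?invr_gt0// => h.
rewrite ler_pdivrMr// mulrAC ler_pdivlMr//.
lra.
Qed.

Lemma hahn_banach : exists l : V -> R,
  (forall a x y, D x -> D y -> l (a *: x + y) = a * l x + l y) /\
  (forall x, D x -> l x <= p x).
Proof.
have [|A [[Alin Ap] Amax]] := @Zorn_bigcup _ dominated_graph.
  move=> F FP Ftot; split.
    move=> a x y [B FB Bx] [C FC Cy].
    have [BC|CB] := Ftot _ _ FB FC.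
    - exists C => //; have [h _] := FP _ FC; apply: h => //; exact: BC.
    - exists B => //; have [h _] := FP _ FB; apply: h => //; exact: CB.
  by move=> x [B FB Bx]; exact: (FP _ FB).2.
have A00 : A (0, 0).
  have [[x Ax]|Ae] := pselect (exists x, A x).
    have := Alin (-1) _ _ Ax Ax.
    by rewrite scaleN1r addNr mulN1r addNr.
  (* The maximal graph could a priori be empty; this is excluded because [(0, 0)] alone is a larger
     dominated graph, by [p0]. *)
  exfalso; apply: (Amax [set (0, 0)]).
    split; first by move=> x Ax; case: Ae; exists x.
    by move=> /(_ (0, 0) erefl) A0; apply: Ae; exists (0, 0).
  split=> [a x y -> ->|x ->] /=; last by [].
  by rewrite scaler0 mulr0 !addr0.
have Atot v : D v -> exists a, A (v, a).
  move=> Dv; apply: contrapT => nA.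
  pose S := [set r | exists x s, [/\ A x, 0 < s & r = (x.2 - p (x.1 - s *: v)) / s]].
  have gap := @extension_gap A v (conj Alin Ap) Dv.
  have S0 : S !=set0 by exists ((0 - p (0 - 1 *: v)) / 1), (0, 0), 1.
  (* The value assigned to [v]: by the gap inequality it separates the lower slopes from the upper
     slopes, so adjoining [(v, a)] keeps the graph below [p] for either sign of the coefficient of
     [v]. *)
  pose a := sup S.
  have aub x s : A x -> 0 < s -> (x.2 - p (x.1 - s *: v)) / s <= a.
    move=> Ax s0; apply: ub_le_sup; last by exists x, s.
    exists ((p (0 + 1 *: v) - 0) / 1) => r [y [t [Ay t0 ->]]].
    exact: (gap y (0, 0) t 1).
  have alb y t : A y -> 0 < t -> a <= (p (y.1 + t *: v) - y.2) / t.
    by move=> Ay t0; apply: ge_sup => // r [x [s [Ax s0 ->]]]; exact: gap.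
  apply: (Amax [set z | exists x t, A x /\ z = (x.1 + t *: v, x.2 + t * a)]).
    split; last first.
      move=> /(_ (v, a)) h; apply: nA; exists a; apply: h.
      by exists (0, 0), 1; rewrite /= !add0r scale1r mul1r.
    move=> x Ax; exists x, 0; split=> //.
    by rewrite scale0r mul0r !addr0; case: x {Ax}.
  split.
    move=> b _ _ [x [s [Ax ->]]] [y [t [Ay ->]]] /=.
    exists (b *: x.1 + y.1, b * x.2 + y.2), (b * s + t); split; first exact: Alin.
    congr pair => /=; last by ring.
    by rewrite scalerDr scalerA scalerDl addrACA.
  move=> _ [x [t [Ax ->]]] /=; split.
    by rewrite addrC; apply: Dlin => //; case: (Ap _ Ax).
  have [t0|t0|->] := ltgtP t 0.
  - have nt0 : 0 < - t by rewrite oppr_gt0.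
    have := aub _ _ Ax nt0; rewrite ler_pdivrMr// scaleNr opprK; lra.
  - by have := alb _ _ Ax t0; rewrite ler_pdivlMr//; lra.
  - by rewrite scale0r mul0r !addr0; case: (Ap _ Ax).
pose l v := xget 0 [set a | A (v, a)].
have Al v : D v -> A (v, l v).
  by move=> /Atot[a Aa]; apply: (@xgetPex _ 0 [set a | A (v, a)]); exists a.
have Auniq v a b : A (v, a) -> A (v, b) -> a = b.
  move=> Aa Ab.
  have A0 := Alin (-1) _ _ Ab Aa; rewrite /= scaleN1r addNr mulN1r in A0.
  apply/eqP; rewrite -subr_eq0; apply/negPn/negP => ab0.
  (* A nonzero value over [0] could be rescaled to [p 0 + 1], against domination at [0]. *)
  have h := (Ap _ (Alin ((p 0 + 1) / (- b + a)) _ _ A0 A00)).2.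
  move: h; rewrite /= scaler0 !addr0 divfK; last by rewrite addrC.
  lra.
exists l; split=> [a x y Dx Dy|x Dx]; last exact: (Ap _ (Al _ Dx)).2.
apply: (Auniq (a *: x + y)); first exact/Al/Dlin.
exact: (Alin a (x, _) (y, _) (Al _ Dx) (Al _ Dy)).
Qed.

End HahnBanach.

(** * Metrizable spaces and Borel regularity *)

Section Metrized.
Variables (R : realType) (T : topologicalType) (d : T -> T -> R).

(** A property of a plain function, not a metric structure, since the points of [Om] already carry
    the subspace topology. *)
Definition metrizes : Prop :=
  [/\ forall x, d x x = 0, forall x y, d x y = d y x,
      forall x y z, d x z <= d x y + d y z &
      forall x A, nbhs x A <-> exists2 e, 0 < e & forall y, d x y < e -> A y].

Hypothesis dT : metrizes.

Lemma metrizes_ge0 x y : 0 <= d x y.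
Proof.
have [d0 dC dD _] := dT.
by have := dD x y x; rewrite d0 [d y x]dC; lra.
Qed.

Lemma lipschitz_continuous (f : T -> R) (c : R) :
  (forall x y, f x <= f y + c * d x y) -> continuous f.
Proof.
have [d0 dC _ dN] := dT.
move=> flip x; apply/cvgrPdist_lt => e e0.
have c0 : 0 < `|c| + 1 by rewrite ltr_wpDl.
apply/(dN x); exists (e / (`|c| + 1)); first by rewrite divr_gt0.
move=> y; rewrite ltr_pdivlMr// => xy.
have := flip x y; have := flip y x; rewrite [d y x]dC.
have : c * d x y <= d x y * (`|c| + 1).
  have := metrizes_ge0 x y; have := ler_norm c; nra.
by rewrite ltr_norml; lra.
Qed.

Lemma usc_approx (v : T -> R) (a b : R) :
  (forall x, a <= v x <= b) ->
  (forall x r, v x < r -> \forall y \near x, v y < r) ->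
  exists w : nat -> T -> R,
    [/\ forall n, continuous (w n), forall n x, v x <= w n x <= b,
        forall x, {homo w^~ x : m n / (m <= n)%N >-> n <= m} &
        forall x e, 0 < e -> exists n, w n x < v x + e].
Proof.
have [d0 dC dD dN] := dT.
move=> vab vusc.
pose S n x := [set v y - n%:R * d x y | y in [set: T]].
have Sb n x : ubound (S n x) b.
  move=> _ [y _ <-]; have /andP[_ vb] := vab y.
  by rewrite lerBlDr (le_trans vb)// lerDl mulr_ge0// metrizes_ge0.
have Sub n x y : v y - n%:R * d x y <= sup (S n x).
  by apply: ub_le_sup; [exists b; exact: Sb | exists y].
have S0 n x : S n x !=set0 by exists (v x - n%:R * d x x), x.
(* Lipschitz regularization: [w n x = sup_y (v y - n d(x, y))]. *)
exists (fun n x => sup (S n x)); split.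
- move=> n; apply: (@lipschitz_continuous _ n%:R) => x y.
  apply: ge_sup => // _ [z _ <-].
  have := Sub n y z; have := dD y x z; rewrite [d y x]dC.
  have : 0 <= n%:R :> R by []; nra.
- move=> n x; apply/andP; split; first by have := Sub n x x; rewrite d0 mulr0 subr0.
  by apply: ge_sup => //; exact: Sb.
- move=> x m n mn; apply: ge_sup => // _ [z _ <-].
  have := Sub m x z; have := metrizes_ge0 x z.
  have : m%:R <= n%:R :> R by rewrite ler_nat.
  nra.
- move=> x e e0.
  have [r r0 hr] : exists2 r, 0 < r & forall y, d x y < r -> v y < v x + e / 2.
    by apply/(dN x)/vusc; rewrite ltrDl divr_gt0.
  (* With this [n], points at distance at least [r] contribute at most [b - (b - a) = a <= v x];
     nearer points contribute less than [v x + e / 2]. *)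
  have [n hn] : exists n : nat, b - a <= n%:R * r.
    exists (Num.bound `|(b - a) / r|).
    by rewrite -ler_pdivrMr//; apply/ltW/(le_lt_trans (ler_norm _))/archi_boundP.
  exists n; apply: (@le_lt_trans _ _ (v x + e / 2)); last by lra.
  apply: ge_sup => // _ [y _ <-].
  have [xy|xy] := ltP (d x y) r.
    have := hr _ xy; have := metrizes_ge0 x y; have : 0 <= n%:R :> R by []; nra.
  have := vab x; have := vab y; have : 0 <= n%:R :> R by []; nra.
Qed.

(** Minus the indicator of [U] is upper semicontinuous, hence a decreasing limit of continuous
    [w n]. The factor 2 in [- 2 * w n] lets the function cut at 1 reach 1 as soon as
    [w n x <= - 1 / 2], so after finitely many steps at each point of [U]. *)
Lemma open_exhaustion (U : set T) : open U ->
  exists k : nat -> T -> R,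
    [/\ forall n, continuous (k n), forall n x, 0 <= k n x <= 1,
        forall x, {homo k^~ x : m n / (m <= n)%N >-> m <= n},
        forall n x, ~ U x -> k n x = 0 & forall x, U x -> exists n, k n x = 1].
Proof.
move=> oU.
have v01 x : - 1 <= - (\1_U x : R) <= 0.
  by rewrite indicE; case: (_ \in _) => /=; lra.
have [x r|w [wc wb wd wl]] := usc_approx v01.
  rewrite indicE; have [xU|xU] /= := boolP (x \in U).
    move=> r1; near=> y; rewrite indicE mem_set//; near: y.
    by apply: open_nbhs_nbhs; split => //; exact: set_mem.
  by move=> r0; near=> y; apply: le_lt_trans r0; rewrite oppr0; have := v01 y; lra.
exists (fun n x => Num.min 1 (- 2 * w n x)); split.
- move=> n x; apply: (@continuous_min _ _ (cst 1) (fun x => - 2 * w n x)).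
    exact: cst_continuous.
  by apply: cvgMl_tmp; exact: wc.
- move=> n x; have := wb n x; rewrite le_min ge_min lexx /=; lra.
- move=> x m n mn; rewrite le_min !ge_min lexx /=; have := wd x _ _ mn => h.
  by apply/orP; right; lra.
- move=> n x Ux; have := wb n x; rewrite indicE memNset//= => h.
  have -> : w n x = 0 by apply/eqP; rewrite eq_le; move: h; rewrite oppr0 andbC.
  by rewrite mulr0; apply/min_idPr; exact: ler01.
- move=> x Ux; have [n] := wl x 2^-1 ltac:(by rewrite invr_gt0).
  rewrite indicE mem_set//= => h; exists n; apply/min_idPl; lra.
Unshelve. all: by end_near. Qed.

End Metrized.

Section BorelSigmaAlgebra.
Variables (R : realType) (T : ptopologicalType).
Local Notation borelT := (g_sigma_algebraType (@open T)).

Lemma borel_open (U : set T) : open U -> measurable (U : set borelT).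
Proof. by move=> oU; exact: sub_sigma_algebra. Qed.

Lemma borel_closed (F : set T) : closed F -> measurable (F : set borelT).
Proof.
move=> cF; rewrite -(setCK F); apply: measurableC; apply: borel_open.
exact: closed_openC.
Qed.

Lemma continuous_borel (f : T -> R) : continuous f ->
  measurable_fun [set: borelT] (f : borelT -> R).
Proof.
move=> /continuousP fc; apply: (measurability _ (RGenOpens.measurableE R)).
move=> _ [_ [a [b ->]] <-]; rewrite setTI; apply: borel_open; apply: fc.
exact: interval_open.
Qed.

End BorelSigmaAlgebra.

(** * Regularity of Borel probability measures by closed and open sets *)

Section Regularity.
Variables (R : realType) (T : ptopologicalType) (d : T -> T -> R).
Hypothesis dT : metrizes d.
Local Notation borelT := (g_sigma_algebraType (@open T)).
Variable P : probability borelT R.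

(** The closed sets where [k n] is at least 1 increase to [U], so the differences decrease to the
    empty set and continuity from above applies. *)
Lemma open_closed_inner (U : set T) (e : R) : open U -> 0 < e ->
  exists F : set T, [/\ closed F, F `<=` U & (P (U `\` F) < e%:E)%E].
Proof.
move=> oU e0; have [k [kc k01 ki k0 k1]] := open_exhaustion dT oU.
pose F n := U `\` (k n @^-1` [set r | 1 <= r]).
have cF n : closed (k n @^-1` [set r | 1 <= r]).
  by apply: closed_comp => [x _|]; [exact: kc | exact: closed_ge].
have mF n : measurable (F n : set borelT).
  by apply: measurableD; [exact: borel_open | exact: borel_closed].
have F0 : \bigcap_n F n = set0.
  rewrite -subset0 => x Fx; have [Ux _] := Fx 0%N I; have [n kn] := k1 _ Ux.
  by have [_] := Fx n I; rewrite /= kn; apply; exact: lexx.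
have h : (P \o F) n @[n --> \oo] --> P (\bigcap_n F n).
  apply: nonincreasing_cvg_mu => //.
  - exact: le_lt_trans (probability_le1 _ _) (ltry _).
  - by rewrite F0.
  - move=> n m nm; apply/subsetPset => x [Ux nk]; split=> // hk; apply: nk => /=.
    exact: le_trans hk (ki x _ _ nm).
move: h; rewrite F0 measure0 => /fine_cvgP [Pf /cvgr0Pnorm_lt /(_ _ e0) Pe].
have [n [fn Pn]] := filter_ex (filterI Pf Pe).
exists (k n @^-1` [set r | 1 <= r]); split => //.
  move=> x /= kx; apply: contrapT => /(k0 n) kx0.
  by move: kx; rewrite kx0 ler10.
move: Pn; rewrite -/(F n) /= ger0_norm ?fine_ge0// => Pn.
by rewrite -[P _]fineK// lte_fin.
Qed.

Definition sandwiched (B : set T) : Prop := forall e : R, 0 < e ->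
  exists F U : set T,
    [/\ closed F, open U, F `<=` B, B `<=` U & (P (U `\` F) < e%:E)%E].

(** The sandwiched sets form a sigma-algebra containing the open sets; taking complements exchanges
    the closed and the open set. *)
Lemma borel_regularity (B : set T) : measurable (B : set borelT) ->
  sandwiched B.
Proof.
suff [s0 sC sU] : sigma_algebra setT sandwiched.
  move=> mB; move: B mB; apply: smallest_sub => //.
  move=> U oU e e0; have [F [cF FU PF]] := open_closed_inner oU e0.
  by exists F, U; split.
split => [|A sA|A sA] e e0.
- exists set0, set0; split => //; first exact: closed0.
    exact: open0.
  by rewrite setD0 measure0 lte_fin.
- have [F [U [cF oU FA AU PUF]]] := sA _ e0.
  exists (~` U), (~` F); split.
  + exact: open_closedC.
  + exact: closed_openC.
  + by rewrite setTD; exact: subsetC.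
  + by rewrite setTD; exact: subsetC.
  + by rewrite setDE setCK setIC -setDE.
- pose en n : R := e / 2 / (2 ^ n.+1)%:R.
  have en0 n : 0 < en n by rewrite /en !divr_gt0// ltr0n expn_gt0.
  have [F hF] := choice (fun n => sA n _ (en0 n)).
  have [U hU] := choice hF.
  (* A countable union of closed sets may fail to be closed, so only finite unions are taken. The
     intersection of the [G n] has measure at most [e / 2], the total of the errors [en], so some
     [G n] has measure below [e]. *)
  pose FF n := \big[setU/set0]_(i < n) F i.
  have cFF n : closed (FF n).
    by rewrite /FF; apply: closed_bigsetU => i _; case: (hU i).
  have oUU : open (\bigcup_n U n) by apply: bigcup_open => n _; case: (hU n).
  pose G n := (\bigcup_n U n) `\` FF n.
  have mG n : measurable (G n : set borelT).
    by apply: measurableD; [exact: borel_open | exact: borel_closed].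
  have mUF n : measurable (U n `\` F n : set borelT).
    by case: (hU n) => cF oU _ _ _;
      apply: measurableD; [exact: borel_open | exact: borel_closed].
  have mUU : measurable (\bigcup_n (U n `\` F n) : set borelT).
    by apply: bigcup_measurable.
  have PG : (P (\bigcap_n G n) <= (e / 2)%:E)%E.
    apply: (@le_trans _ _ (P (\bigcup_n (U n `\` F n)))).
      apply: le_measure; rewrite ?inE//; first exact: bigcap_measurable.
      move=> x Gx; have [[n _ Unx] _] := Gx 0%N I; exists n => //; split=> // Fnx.
      have [_] := Gx n.+1 I; apply; rewrite /FF -bigcup_mkord.
      by exists n => //=.
    apply: (le_trans (measure_sigma_subadditive _ mUF mUU _)) => //.
    (* The summand 0 gives the series the shape that [epsilon_trick] expects. *)
    apply: (@le_trans _ _ (\sum_(0 <= n <oo) (0 + (en n)%:E))%E).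
      by apply: lee_nneseries => // n _; rewrite add0e ltW//; case: (hU n).
    apply: (le_trans (epsilon_trick _ _ _)) => //; first by lra.
    by rewrite eseries0 ?add0e.
  have h : (P \o G) n @[n --> \oo] --> P (\bigcap_n G n).
    apply: nonincreasing_cvg_mu => //.
    - exact: le_lt_trans (probability_le1 _ _) (ltry _).
    - exact: bigcap_measurable.
    - move=> n m nm; apply/subsetPset => x [Ux nF]; split=> // hF'; apply: nF.
      move: hF'; rewrite /FF -!bigcup_mkord => -[i /= im Fx]; exists i => //=.
      exact: leq_trans im nm.
  have [n Pn] : exists n, (P (G n) < e%:E)%E.
    have /filter_ex[n] : \forall n \near \oo, ((P \o G) n < e%:E)%E; last by exists n.
    apply: (h [set y | (y < e%:E)%E]); apply: open_nbhs_nbhs.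
    split; first exact: open_ereal_lt_ereal.
    by apply: le_lt_trans PG _; rewrite lte_fin ltr_pdivrMr// mulr_natr mulr2n ltrDl.
  exists (FF n), (\bigcup_n U n); split => //.
  + rewrite /FF -bigcup_mkord => x [i _ Fx]; exists i => //.
    by case: (hU i) => _ _ + _ _; exact.
  + by move=> x [i _ Ax]; exists i => //; case: (hU i) => _ _ _ + _; exact.
Qed.

End Regularity.

(** * Daniell representation *)

Section DaniellRepresentation.
Variables (R : realType) (T : ptopologicalType) (d : T -> T -> R) (Z : T -> R).
Hypotheses (dT : metrizes d) (Z1 : forall x, 1 <= Z x).
Local Notation borelT := (g_sigma_algebraType (@open T)).

Definition cont_dominated (f : T -> R) : Prop :=
  continuous f /\ exists c, forall x, `|f x| <= c * Z x.

Local Notation CD := cont_dominated.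

Lemma cont_dominated_bounded (f : T -> R) (c : R) :
  continuous f -> (forall x, `|f x| <= c) -> CD f.
Proof.
move=> cf fc; split=> //; exists `|c| => x; have := fc x; have := Z1 x.
have := ler_norm c; have := normr_ge0 c; have := normr_ge0 (f x); nra.
Qed.

Lemma cont_dominated_cst (c : R) : CD (fun=> c).
Proof. by apply: (@cont_dominated_bounded _ `|c|) => // x; exact: cvg_cst. Qed.

Lemma cont_dominated_lin a f g : CD f -> CD g -> CD (fun x => a * f x + g x).
Proof.
move=> [cf [b fb]] [cg [c gc]]; split.
  by move=> x; apply: cvgD; [apply: cvgMl_tmp; exact: cf | exact: cg].
exists (`|a| * b + c) => x; apply: le_trans (ler_normD _ _) _.
by rewrite mulrDl lerD// normrM -mulrA ler_wpM2l.
Qed.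

Lemma cont_dominated_mulr f g (c : R) : CD f -> continuous g ->
  (forall x, `|g x| <= c) -> CD (fun x => f x * g x).
Proof.
move=> [cf [b fb]] cg gc; split; first by move=> x; exact: cvgM (cf x) (cg x).
exists (b * c) => x; rewrite normrM mulrAC; apply: ler_pM => //.
Qed.

Lemma cont_dominated_min f g : CD f -> CD g -> CD (fun x => Num.min (f x) (g x)).
Proof.
move=> [cf [b fb]] [cg [c gc]]; split.
  by move=> x; apply: continuous_min; [exact: cf | exact: cg].
exists (`|b| + `|c|) => x; have := fb x; have := gc x; have := Z1 x.
have := ler_norm b; have := ler_norm c; rewrite !ler_norml => b1 c1 z1 h1 h2.
have ? : b * Z x <= `|b| * Z x by rewrite ler_wpM2r//; lra.
have ? : c * Z x <= `|c| * Z x by rewrite ler_wpM2r//; lra.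
have ? : 0 <= `|b| * Z x by rewrite mulr_ge0//; lra.
have ? : 0 <= `|c| * Z x by rewrite mulr_ge0//; lra.
by rewrite minElt; case: ifP => _; lra.
Qed.

Lemma cont_dominated_max f g : CD f -> CD g -> CD (fun x => Num.max (f x) (g x)).
Proof.
move=> Cf Cg.
have CN h : CD h -> CD (fun x => -1 * h x + 0).
  by move=> Ch; apply: cont_dominated_lin => //; exact: cont_dominated_cst.
have -> : (fun x => Num.max (f x) (g x)) =
    (fun x => -1 * Num.min (-1 * f x + 0) (-1 * g x + 0) + 0).
  by apply/funext => x; rewrite !addr0 !mulN1r oppr_min !opprK.
by apply: (CN _); apply: cont_dominated_min; exact: (CN _).
Qed.

Variable l : (T -> R) -> R.
Hypothesis l_lin : forall a f g, CD f -> CD g ->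
  l (fun x => a * f x + g x) = a * l f + l g.
Hypothesis l_pos : forall f, CD f -> (forall x, 0 <= f x) -> 0 <= l f.
Hypothesis l_one : l (fun=> 1) = 1.
Hypothesis l_daniell : forall f : nat -> T -> R, (forall n, CD (f n)) ->
  (forall n x, 0 <= f n x) ->
  (forall x, {homo f^~ x : m n / (m <= n)%N >-> n <= m}) ->
  (forall x e, 0 < e -> exists n, f n x < e) ->
  forall e, 0 < e -> exists n, l (f n) < e.

Local Notation cst0 := (fun=> 0 : R).

Lemma daniell_zero : l cst0 = 0.
Proof.
have C0 := cont_dominated_cst 0.
have := l_lin 1 C0 C0.
have -> : (fun _ : T => 1 * 0 + 0) = cst0 :> (T -> R).
  by apply/funext => x; rewrite mulr0 addr0.
lra.
Qed.

Lemma daniell_scale a f : CD f -> l (fun x => a * f x) = a * l f.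
Proof.
move=> Cf; have := l_lin a Cf (cont_dominated_cst 0); rewrite daniell_zero addr0.
by move=> <-; congr l; apply/funext => x; rewrite addr0.
Qed.

Lemma daniell_add f g : CD f -> CD g -> l (fun x => f x + g x) = l f + l g.
Proof.
move=> Cf Cg; have := l_lin 1 Cf Cg; rewrite mul1r => <-.
by congr l; apply/funext => x; rewrite mul1r.
Qed.

Lemma daniell_sub f g : CD f -> CD g -> l (fun x => f x - g x) = l f - l g.
Proof.
move=> Cf Cg; have := l_lin (-1) Cg Cf; rewrite mulN1r addrC => <-.
by congr l; apply/funext => x; rewrite mulN1r addrC.
Qed.

Lemma cont_dominated_add f g : CD f -> CD g -> CD (fun x => f x + g x).
Proof.
move=> Cf Cg; have := cont_dominated_lin 1 Cf Cg.
by congr CD; apply/funext => x; rewrite mul1r.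
Qed.

Lemma cont_dominated_sub f g : CD f -> CD g -> CD (fun x => f x - g x).
Proof.
move=> Cf Cg; have := cont_dominated_lin (-1) Cg Cf.
by congr CD; apply/funext => x; rewrite mulN1r addrC.
Qed.

Lemma cont_dominated_scale a f : CD f -> CD (fun x => a * f x).
Proof.
move=> Cf; have := cont_dominated_lin a Cf (cont_dominated_cst 0).
by congr CD; apply/funext => x; rewrite addr0.
Qed.

Lemma daniell_mono f g : CD f -> CD g -> (forall x, f x <= g x) -> l f <= l g.
Proof.
move=> Cf Cg fg; rewrite -subr_ge0 -daniell_sub//; apply: l_pos => [|x].
  exact: cont_dominated_sub.
by rewrite subr_ge0.
Qed.

Lemma cont_dominated_sum n (f : nat -> T -> R) : (forall i, CD (f i)) ->
  CD (fun x => \sum_(i < n) f i x).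
Proof.
move=> Cf; elim: n => [|n IH].
  by under eq_fun do rewrite big_ord0; exact: cont_dominated_cst.
by under eq_fun do rewrite big_ord_recr; exact: cont_dominated_add.
Qed.

Lemma daniell_sum n (f : nat -> T -> R) : (forall i, CD (f i)) ->
  l (fun x => \sum_(i < n) f i x) = \sum_(i < n) l (f i).
Proof.
move=> Cf; elim: n => [|n IH].
  by under eq_fun do rewrite big_ord0; rewrite big_ord0 daniell_zero.
under eq_fun do rewrite big_ord_recr; rewrite big_ord_recr daniell_add// ?IH//.
exact: cont_dominated_sum.
Qed.

(* Outer measure by covers: [g n] increases to a function that is at least 1 on
   [E], and [c] bounds its cost [sup_n l (g n)]. *)
Definition daniell_cover (E : set T) (c : R) : Prop :=
  exists g : nat -> T -> R,
    [/\ forall n, CD (g n), forall n x, 0 <= g n x,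
        forall x, {homo g^~ x : m n / (m <= n)%N >-> m <= n},
        forall n, l (g n) <= c & forall x, E x -> exists n, 1 <= g n x].

Lemma daniell_cover_ge0 E c : daniell_cover E c -> 0 <= c.
Proof. by move=> [g [Cg g0 _ gc _]]; apply: le_trans (gc 0%N); exact: l_pos. Qed.

Lemma daniell_cover_sub E F c : E `<=` F -> daniell_cover F c -> daniell_cover E c.
Proof. by move=> EF [g [? ? ? ? h]]; exists g; split=> // x /EF; exact: h. Qed.

Lemma daniell_cover_level (f : T -> R) : CD f -> (forall x, 0 <= f x) ->
  daniell_cover [set x | 1 <= f x] (l f).
Proof.
move=> Cf f0; exists (fun=> f).
by split=> // [x m n _|x fx]; [exact: lexx | exists 0%N].
Qed.

Lemma daniell_cover_setT : daniell_cover setT 1.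
Proof.
have := daniell_cover_level (cont_dominated_cst 1) (fun=> ler01).
by rewrite l_one; apply: daniell_cover_sub => x _ /=.
Qed.

(** The positive part of [1 - g n] decreases to 0 pointwise, so Daniell continuity makes its value
    under [l] less than [e]; adding [g n] to it dominates the constant 1. *)
Lemma daniell_cover_setT_ge1 c : daniell_cover setT c -> 1 <= c.
Proof.
move=> [g [Cg g0 gi gc g1]]; apply/ler_addgt0Pr => e e0.
pose f n x := Num.max (1 - g n x) 0.
have Cf n : CD (f n).
  apply: cont_dominated_max; last exact: cont_dominated_cst.
  by apply: cont_dominated_sub => //; exact: cont_dominated_cst.
have [|||n fn] := l_daniell Cf _ _ _ e0.
- by move=> n x; rewrite le_max lexx orbT.
- move=> x m n mn; rewrite /f ge_max le_max; have := gi x _ _ mn.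
  by rewrite le_max lexx orbT andbT => h; apply/orP; left; lra.
- move=> x r r0; have [n gn] := g1 x I; exists n.
  by rewrite /f; have -> : Num.max (1 - g n x) 0 = 0; [apply/max_idPr; lra | exact: r0].
have : l (fun=> 1) <= l (fun x => f n x + g n x).
  apply: daniell_mono; [exact: cont_dominated_cst | exact: cont_dominated_add |].
  by move=> x; rewrite -lerBlDr /f le_max lexx.
rewrite daniell_add// l_one; have := gc n; lra.
Qed.

Definition daniell_measure (E : set T) : \bar R :=
  ereal_inf [set c%:E | c in daniell_cover E].

Local Notation mu := daniell_measure.

Lemma daniell_measure_le E c : daniell_cover E c -> (mu E <= c%:E)%E.
Proof. by move=> Ec; apply: ereal_inf_lbound; exists c. Qed.

Lemma daniell_measure_ge0 E : (0 <= mu E)%E.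
Proof.
by apply: le_ereal_inf_tmp => _ [c /daniell_cover_ge0 c0 <-]; rewrite lee_fin.
Qed.

Lemma daniell_measure_mono : {homo mu : A B / A `<=` B >-> (A <= B)%E}.
Proof.
move=> A B AB; apply: le_ereal_inf_tmp => _ [c Bc <-].
exact/daniell_measure_le/(daniell_cover_sub AB).
Qed.

Lemma daniell_measure0 : mu set0 = 0%E.
Proof.
apply/eqP; rewrite eq_le daniell_measure_ge0 andbT; apply: daniell_measure_le.
exists (fun=> cst0); split => // [|_ ? ? _|_]; [|exact: lexx|].
  by move=> _; exact: cont_dominated_cst.
by rewrite (_ : l _ = 0) ?lexx//; exact: daniell_zero.
Qed.

Lemma daniell_measure_setT : mu setT = 1%E.
Proof.
apply/eqP; rewrite eq_le daniell_measure_le/=; last exact: daniell_cover_setT.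
by apply: le_ereal_inf_tmp => _ [c /daniell_cover_setT_ge1 c1 <-]; rewrite lee_fin.
Qed.

Lemma daniell_measure_fin_num E : mu E \is a fin_num.
Proof.
rewrite ge0_fin_numE ?daniell_measure_ge0//.
apply: (@le_lt_trans _ _ 1%E); last exact: ltry.
by rewrite -daniell_measure_setT; exact: daniell_measure_mono.
Qed.

Lemma daniell_cover_approx E (e : R) : 0 < e ->
  exists2 c, daniell_cover E c & (c%:E <= mu E + e%:E)%E.
Proof.
move=> e0; have [_ [c Ec <-] ce] :=
  lb_ereal_inf_adherent e0 (daniell_measure_fin_num E).
by exists c => //; exact: ltW.
Qed.

(** Diagonal argument: if [g i] covers [F i] at cost [c i], the sums of [g i n] over [i < n]
    increase with [n], cost at most the sum of the [c i], and cover the union. *)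
Lemma daniell_measure_sigma_subadditive : sigma_subadditive mu.
Proof.
move=> F; apply/lee_addgt0Pr => e e0.
pose en n : R := e / (2 ^ n.+1)%:R.
have en0 n : 0 < en n by rewrite /en divr_gt0// ltr0n expn_gt0.
have cP n : exists c, daniell_cover (F n) c /\ (c%:E <= mu (F n) + (en n)%:E)%E.
  by have [c ? ?] := daniell_cover_approx (F n) (en0 n); exists c.
have [c hc] := choice cP.
have c0 n : (0 <= (c n)%:E)%E by rewrite lee_fin; exact: daniell_cover_ge0 (hc n).1.
pose S := (\sum_(0 <= i <oo) (c i)%:E)%E.
have S0 : (0 <= S)%E by apply: nneseries_ge0.
apply: (@le_trans _ _ S); last first.
  apply: (@le_trans _ _ (\sum_(0 <= i <oo) (mu (F i) + (en i)%:E))%E).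
    by apply: lee_nneseries => // n _; exact: (hc n).2.
  by apply: epsilon_trick; [move=> n; exact: daniell_measure_ge0 | exact: ltW].
have [Sfin|] := boolP (S \is a fin_num); last first.
  by rewrite ge0_fin_numE// -leNgt leye_eq => /eqP ->; exact: leey.
rewrite -(fineK Sfin); apply: daniell_measure_le.
have [g hg] := choice (fun n => (hc n).1).
have gC i n : CD (g i n) by case: (hg i).
have g0 i n x : 0 <= g i n x by case: (hg i).
have gi i x m n : (m <= n)%N -> g i m x <= g i n x.
  by case: (hg i) => _ _ h _ _; exact: h.
exists (fun n x => \sum_(i < n) g i n x); split.
- by move=> n; apply: (@cont_dominated_sum n (fun i => g i n)).
- by move=> n x; exact: sumr_ge0.
- move=> x m n mn; apply: (@le_trans _ _ (\sum_(i < m) g i n x)).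
    by apply: ler_sum => i _; exact: gi.
  rewrite -!(big_mkord xpredT (fun i => g i n x)) (big_cat_nat _ mn)//=.
  by rewrite lerDl sumr_ge0.
- move=> n; rewrite (@daniell_sum n (fun i => g i n))//.
  rewrite -lee_fin (fineK Sfin); apply: (@le_trans _ _ (\sum_(0 <= i < n) (c i)%:E)%E).
    rewrite sumEFin lee_fin big_mkord; apply: ler_sum => i _.
    by case: (hg i) => _ _ _ h _; exact: h.
  exact: nneseries_lim_ge.
- move=> x [i _ Fx]; have [_ _ _ _ /(_ x Fx) [n gn]] := hg i.
  (* The index must exceed [i] for the term to occur in the sum, and be at least [n] for it to have
     reached 1. *)
  have iN : (i < maxn i.+1 n)%N by rewrite leq_max ltnSn.
  exists (maxn i.+1 n); rewrite (bigD1 (Ordinal iN))//=.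
  apply: (@le_trans _ _ (g i (maxn i.+1 n) x)).
    by apply: le_trans gn _; apply: gi; exact: leq_maxr.
  by rewrite lerDl sumr_ge0.
Qed.

HB.instance Definition _ := isOuterMeasure.Build R T daniell_measure
  daniell_measure0 daniell_measure_ge0 daniell_measure_mono
  daniell_measure_sigma_subadditive.

(* If [g n] covers [X] and [k n] increases to the indicator of [U], then
   [g n * k n] covers [X `&` U] and [g n * (1 - k N)] covers [X `\` U] for every
   fixed [N]; taking [N] large makes the two costs add up to that of [g]. *)
Lemma open_daniell_caratheodory (U X : set T) : open U ->
  (mu (X `&` U) + mu (X `&` ~` U) <= mu X)%E.
Proof.
move=> oU; have [k [kc k01 ki k0 k1]] := open_exhaustion dT oU.
have kb n x : `|k n x| <= 1 by rewrite ger0_norm; case/andP: (k01 n x).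
apply/lee_addgt0Pr => e e0.
have e20 : 0 < e / 2 by rewrite divr_gt0.
have [c [g [Cg g0 gi gc g1]] ce] := daniell_cover_approx X e20.
have Cgk m n : CD (fun x => g m x * k n x) by apply: cont_dominated_mulr.
have gkle m n x : g m x * k n x <= g m x.
  by rewrite ler_piMr//; case/andP: (k01 n x).
pose S := [set l (fun x => g n x * k n x) | n in [set: nat]].
have Sub : has_ubound S.
  exists c => _ [n _ <-]; apply: le_trans (gc n); exact: daniell_mono.
have S0 : S !=set0 by exists (l (fun x => g 0%N x * k 0%N x)), 0%N.
pose a := sup S.
have ha n : l (fun x => g n x * k n x) <= a by apply: ub_le_sup => //; exists n.
have [_ [N _ <-] hN] := sup_adherent e20 (conj S0 Sub).
have h1 : (mu (X `&` U) <= a%:E)%E.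
  apply: daniell_measure_le; exists (fun n x => g n x * k n x); split=> //.
  - by move=> n x; rewrite mulr_ge0//; case/andP: (k01 n x).
  - move=> x m n mn; apply: ler_pM => //; [|exact: gi|exact: ki].
    by case/andP: (k01 m x).
  - move=> x [Xx Ux]; have [m gm] := g1 _ Xx; have [n kn] := k1 _ Ux.
    exists (maxn m n); rewrite -[leLHS]mulr1; apply: ler_pM => //.
      by apply: le_trans gm _; apply: gi; exact: leq_maxl.
    by rewrite -kn; apply: ki; exact: leq_maxr.
have Cg1k m : CD (fun x => g m x - g m x * k N x) by exact: cont_dominated_sub.
have g1k0 m x : 0 <= g m x - g m x * k N x by rewrite subr_ge0.
have g1ki x : {homo (fun m => g m x - g m x * k N x) : m n / (m <= n)%N >-> m <= n}.
  move=> m n mn; have := gi x _ _ mn; have := k01 N x; nra.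
have h2 : (mu (X `&` ~` U) <= (c - a + e / 2)%:E)%E.
  apply: daniell_measure_le; exists (fun n x => g n x - g n x * k N x); split=> //.
  - move=> n.
    apply: (@le_trans _ _ (l (fun x => g (maxn n N) x - g (maxn n N) x * k N x))).
      by apply: daniell_mono => // x; apply: (g1ki x); exact: leq_maxl.
    rewrite daniell_sub//.
    have h : l (fun x => g N x * k N x) <= l (fun x => g (maxn n N) x * k N x).
      apply: daniell_mono => // x; apply: ler_wpM2r; first by case/andP: (k01 N x).
      by apply: gi; exact: leq_maxr.
    by have := gc (maxn n N); rewrite -/a in hN; lra.
  - move=> x [Xx Ux]; have [n gn] := g1 _ Xx; exists n.
    by rewrite (k0 _ _ Ux) mulr0 subr0.
apply: le_trans (leeD h1 h2) _; rewrite -EFinD.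
apply: (@le_trans _ _ (c%:E + (e / 2)%:E)%E); first by rewrite -EFinD lee_fin; lra.
apply: le_trans (leeD2r _ ce) _.
by rewrite -addeA -EFinD leeD2l// lee_fin; lra.
Qed.


(** * The Borel probability measure given by the outer measure *)

Lemma borel_daniell_caratheodory (B : set T) : measurable (B : set borelT) ->
  mu.-cara.-measurable (B : set (caratheodory_type mu)).
Proof.
move: B; apply: smallest_sub; first exact: sigma_algebra_measurable.
by move=> U oU; apply: le_caratheodory_measurable => X; exact: open_daniell_caratheodory.
Qed.

(** The outer measure with its argument typed over the Borel sigma-algebra, so that the measure
    instances attach there and not to the Caratheodory one. *)
Definition daniell_borel (B : set borelT) : \bar R := mu B.

Lemma daniell_borel0 : daniell_borel set0 = 0%E.
Proof. exact: daniell_measure0. Qed.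

Lemma daniell_borel_ge0 B : (0 <= daniell_borel B)%E.
Proof. exact: daniell_measure_ge0. Qed.

Lemma daniell_borel_sigma_additive : semi_sigma_additive daniell_borel.
Proof.
move=> F mF tF mUF.
apply: (@caratheodory_measure_sigma_additive _ _ daniell_measure) => //.
- by move=> n; exact: borel_daniell_caratheodory.
- exact: borel_daniell_caratheodory.
Qed.

HB.instance Definition _ := isMeasure.Build _ borelT R daniell_borel
  daniell_borel0 daniell_borel_ge0 daniell_borel_sigma_additive.

HB.instance Definition _ := Measure_isProbability.Build _ borelT R daniell_borel
  daniell_measure_setT.

Definition daniell_probability : probability borelT R := daniell_borel.

Local Notation P := daniell_probability.

(** * Integration against the measure recovers the functional *)

Lemma cont_dominated_measurable (f : T -> R) : CD f ->
  measurable_fun [set: borelT] (EFin \o f : borelT -> \bar R).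
Proof. by move=> [cf _]; apply/measurable_EFinP; exact: continuous_borel. Qed.

(** The layer of [y] between the heights [j] and [j + 1]. *)
Definition ramp (j : nat) (y : R) := Num.min (Num.max (y - j%:R) 0) 1.

Lemma sum_ramp K y : 0 <= y -> \sum_(j < K) ramp j y = Num.min y K%:R.
Proof.
move=> y0; elim: K => [|K IH].
  by rewrite big_ord0; apply/esym/min_idPr.
rewrite big_ord_recr/= IH /ramp -natr1.
have K0 : 0 <= K%:R :> R by [].
have [yK|Ky] := leP y K%:R.
  have -> : Num.max (y - K%:R) 0 = 0 by apply/max_idPr; lra.
  have -> : Num.min 0 1 = 0 :> R by apply/min_idPl; exact: ler01.
  by rewrite addr0; apply/esym/min_idPl; lra.
have -> : Num.max (y - K%:R) 0 = y - K%:R by apply/max_idPl; lra.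
have [yK1|Ky1] := leP y (K%:R + 1).
  have -> : Num.min (y - K%:R) 1 = y - K%:R by apply/min_idPl; lra.
  by ring.
by congr (_ + _); apply/min_idPr; lra.
Qed.

Lemma ramp01 j y : 0 <= ramp j y <= 1.
Proof. by rewrite /ramp ge_min lexx orbT andbT le_min ler01 andbT le_max lexx orbT. Qed.

(* Layer cake: [ramp j.+1 f] is below the indicator of [1 <= ramp j f], whose
   measure is at most [l (ramp j f)]; summing loses only the layer [j = 0], and
   scaling [f] later makes this loss negligible. *)
Lemma daniell_integral_trunc (f : T -> R) K : CD f -> (forall x, 0 <= f x) ->
  (\int[P]_x (Num.min (f x) K%:R)%:E <= (1 + l f)%:E)%E.
Proof.
move=> Cf f0.
have Cr j : CD (fun x => ramp j (f x)).
  apply: cont_dominated_min; last exact: cont_dominated_cst.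
  apply: cont_dominated_max; last exact: cont_dominated_cst.
  by apply: cont_dominated_sub => //; exact: cont_dominated_cst.
have r0 j x : (0 <= (ramp j (f x))%:E)%E.
  by rewrite lee_fin; case/andP: (ramp01 j (f x)).
have mr j : measurable_fun [set: borelT] (fun x => (ramp j (f x))%:E).
  exact: (cont_dominated_measurable (Cr j)).
have h0 : (\int[P]_x (ramp 0 (f x))%:E <= 1)%E.
  have <- : (\int[P]_(x in setT) (cst 1%E x) = 1)%E.
    by rewrite integral_cst// mul1e; exact: daniell_measure_setT.
  apply: ge0_le_integral => // x _.
  by rewrite lee_fin; case/andP: (ramp01 0 (f x)).
have hS j : (\int[P]_x (ramp j.+1 (f x))%:E <= (l (fun x => ramp j (f x)))%:E)%E.
  pose E := [set x | 1 <= ramp j (f x)].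
  have mE : measurable (E : set borelT).
    apply: borel_closed; apply: (@closed_comp _ _ (fun x => ramp j (f x)) [set r | 1 <= r]).
      by move=> x _; exact: (Cr j).1.
    exact: closed_ge.
  apply: (@le_trans _ _ (P E)); last first.
    apply: daniell_measure_le; apply: daniell_cover_level => // x.
    by case/andP: (ramp01 j (f x)).
  have <- : (\int[P]_(x in setT) (\1_E x)%:E = P E)%E by rewrite integral_indic// setIT.
  apply: ge0_le_integral => //.
    by apply/measurable_EFinP; exact: measurable_indic.
  move=> x _; rewrite lee_fin indicE; have [_|/negP xE] := boolP (x \in E).
    by case/andP: (ramp01 j.+1 (f x)).
  have {}xE : ~~ (1 <= ramp j (f x)) by apply/negP => h; apply: xE; exact: mem_set.
  have fj : f x - j%:R < 1.
    rewrite ltNge; apply: contra xE => h.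
    by rewrite /ramp le_min lexx andbT le_max h.
  by rewrite /ramp ge_min ge_max lexx andbT -natr1 /=; apply/orP; left; lra.
have -> : (\int[P]_x (Num.min (f x) K%:R)%:E =
    \sum_(j < K) \int[P]_x (ramp j (f x))%:E)%E.
  transitivity (\int[P]_x (\sum_(j < K) (ramp j (f x))%:E)%E)%E.
    by apply: eq_integral => x _; rewrite sumEFin sum_ramp.
  by rewrite -(ge0_integral_sum P measurableT).
have lf0 : 0 <= l f by exact: l_pos.
case: K => [|K]; first by rewrite big_ord0 lee_fin; lra.
rewrite big_ord_recl EFinD; apply: leeD => //.
apply: (@le_trans _ _ (\sum_(j < K) (l (fun x => ramp j (f x)))%:E)%E).
  by apply: lee_sum => j _; exact: hS.
rewrite sumEFin lee_fin -(daniell_sum K Cr).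
apply: daniell_mono => //; first exact: (cont_dominated_sum K Cr).
by move=> x; rewrite sum_ramp// ge_min lexx.
Qed.

(** Monotone convergence removes the truncation but leaves the additive constant 1. Applying this to
    [N * f] and dividing by [N] reduces the constant to [1 / N]. *)
Lemma daniell_integral_le (f : T -> R) : CD f -> (forall x, 0 <= f x) ->
  (\int[P]_x (f x)%:E <= (l f)%:E)%E.
Proof.
have h g : CD g -> (forall x, 0 <= g x) -> (\int[P]_x (g x)%:E <= (1 + l g)%:E)%E.
  move=> Cg g0.
  pose gn n x := (Num.min (g x) n%:R)%:E.
  have := @cvg_monotone_convergence _ borelT R P setT measurableT gn _ _ _.
  have -> : (fun x => limn (gn^~ x)) = (fun x => (g x)%:E).
    apply/funext => x; apply: lim_near_cst => //.
    near=> n; rewrite /gn; congr EFin; apply/min_idPl; near: n.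
    exact: nbhs_infty_ger.
  move=> hcvg; apply: (cvge_to_le (hcvg _ _ _)).
  - move=> n; apply: (@cont_dominated_measurable (fun x => Num.min (g x) n%:R)).
    by apply: cont_dominated_min => //; exact: cont_dominated_cst.
  - by move=> n x _; rewrite lee_fin le_min g0 ler0n.
  - move=> x _ m n mn; rewrite lee_fin le_min !ge_min lexx/= ler_nat mn.
    by rewrite orbT.
  - by near=> n; exact: daniell_integral_trunc.
move=> Cf f0; apply/lee_addgt0Pr => e e0.
pose N := (Num.bound e^-1).+1%:R : R.
have N0 : 0 < N by rewrite ltr0n.
have eN : N^-1 <= e.
  rewrite invf_ple ?posrE//; apply: (@le_trans _ _ (Num.bound e^-1)%:R).
    by apply/ltW/archi_boundP; rewrite invr_ge0 ltW.
  by rewrite ler_nat.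
have := h _ (cont_dominated_scale N Cf) (fun x => mulr_ge0 (ltW N0) (f0 x)).
have -> : (\int[P]_x (N * f x)%:E = N%:E * \int[P]_x (f x)%:E)%E.
  under eq_integral do rewrite EFinM.
  rewrite ge0_integralZl//; last by rewrite lee_fin ltW.
    exact: cont_dominated_measurable.
  by move=> x _; rewrite lee_fin.
rewrite daniell_scale// -lee_pdivlMl//; move=> /le_trans; apply.
by rewrite -EFinM -EFinD lee_fin mulrDr mulr1 mulKf ?gt_eqF// addrC lerD2l.
Unshelve. all: by end_near. Qed.

Lemma daniell_integrable (f : T -> R) : CD f ->
  P.-integrable setT (EFin \o f : borelT -> \bar R).
Proof.
move=> Cf; apply/integrableP; split; first exact: cont_dominated_measurable.
have Ca : CD (fun x => `|f x|).
  case: Cf => cf [c fc]; split; last by exists c => x; rewrite normr_id.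
  by move=> x; apply: cvg_norm; exact: cf.
apply: le_lt_trans (ltry (l (fun x => `|f x|))).
exact: daniell_integral_le.
Qed.

(** For [g] bounded by [M], the upper bound is applied to [M - g]. In general [f - min f n]
    decreases to 0, so by Daniell continuity truncation costs less than [e] under [l]. *)
Lemma daniell_integral_ge (f : T -> R) : CD f -> (forall x, 0 <= f x) ->
  ((l f)%:E <= \int[P]_x (f x)%:E)%E.
Proof.
have bnd g M : CD g -> (forall x, 0 <= g x <= M) -> ((l g)%:E <= \int[P]_x (g x)%:E)%E.
  move=> Cg g0.
  have CM := cont_dominated_cst M.
  have := daniell_integral_le (cont_dominated_sub CM Cg) _.
  under eq_integral do rewrite EFinB.
  rewrite integralB//; [|exact: (daniell_integrable CM)|exact: daniell_integrable].
  have -> : (\int[P]_x M%:E = M%:E)%E.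
    rewrite integral_cst// -[RHS]mule1; congr (_ * _)%E.
    exact: daniell_measure_setT.
  have lM : l (fun=> M) = M.
    have := daniell_scale M (cont_dominated_cst 1); rewrite l_one mulr1 => {2}<-.
    by congr l; apply/funext => x; rewrite mulr1.
  rewrite daniell_sub// lM.
  have /fineK <- : (\int[P]_x (g x)%:E)%E \is a fin_num.
    by apply: integrable_fin_num => //; exact: daniell_integrable.
  rewrite -EFinB !lee_fin => h.
  have : M - fine (\int[P]_x (g x)%:E)%E <= M - l g.
    by apply: h => x; rewrite subr_ge0; case/andP: (g0 x).
  lra.
move=> Cf f0; apply/lee_addgt0Pr => e e0.
have Cm n : CD (fun x => Num.min (f x) n%:R).
  by apply: cont_dominated_min => //; exact: cont_dominated_cst.
have [||||n] := @l_daniell (fun n x => f x - Num.min (f x) n%:R) _ _ _ _ e e0.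
- by move=> n; exact: cont_dominated_sub.
- by move=> n x; rewrite subr_ge0 ge_min lexx.
- move=> x m n mn; rewrite lerB// le_min !ge_min lexx/=.
  by rewrite ler_nat mn orbT.
- move=> x r r0; exists (Num.bound (f x)).
  suff -> : Num.min (f x) (Num.bound (f x))%:R = f x by rewrite subrr.
  by apply/min_idPl/ltW/archi_boundP.
rewrite daniell_sub// => h.
apply: (@le_trans _ _ ((l (fun x => Num.min (f x) n%:R))%:E + e%:E)%E).
  by rewrite -EFinD lee_fin; lra.
apply: leeD2r; apply: le_trans (bnd _ n%:R _ _) _ => //.
  by move=> x; rewrite le_min f0 ler0n ge_min lexx orbT.
apply: ge0_le_integral => //.
- by move=> x _; rewrite lee_fin le_min f0 ler0n.
- exact: (cont_dominated_measurable (Cm n)).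
- exact: cont_dominated_measurable.
- by move=> x _; rewrite lee_fin ge_min lexx.
Qed.

Lemma daniell_integral (f : T -> R) : CD f -> (\int[P]_x (f x)%:E = (l f)%:E)%E.
Proof.
have h g : CD g -> (forall x, 0 <= g x) -> (\int[P]_x (g x)%:E = (l g)%:E)%E.
  move=> Cg g0; apply/eqP; rewrite eq_le.
  by rewrite daniell_integral_le// daniell_integral_ge.
move=> Cf.
have C0 := cont_dominated_cst 0.
have Cp := cont_dominated_max Cf C0.
have Cn := cont_dominated_sub Cp Cf.
have p0 x : 0 <= Num.max (f x) 0 by rewrite le_max lexx orbT.
have n0 x : 0 <= Num.max (f x) 0 - f x by rewrite subr_ge0 le_max lexx.
have -> : (fun x => (f x)%:E) =
    (fun x => (Num.max (f x) 0)%:E - (Num.max (f x) 0 - f x)%:E)%E.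
  by apply/funext => x; rewrite -EFinB; congr EFin; ring.
rewrite integralB//; [|exact: (daniell_integrable Cp)|exact: (daniell_integrable Cn)].
by rewrite !h// -EFinB daniell_sub//; congr EFin; ring.
Qed.

End DaniellRepresentation.

(** * Superhedging duality *)

Section SuperhedgingDuality.
Variables (R : realType) (J T : nat) (Om : set 'M[R]_(T, J.+1)).
Variables (x0 : set_type Om) (Z : OmT x0 -> R).
Hypotheses (Zcont : continuous Z) (Z1 : forall w, 1 <= Z w).
Hypothesis Zcpt : forall z : R, 0 <= z -> compact [set w | Z w <= z].
Variables (G A : set (OmT x0 -> R)).
Hypotheses (GB : forall X, G X -> Borel X) (AB : forall X, A X -> Borel X).
Hypothesis G0 : G (fun _ => 0).
Hypothesis BpA : forall X, Borel X -> (forall w, 0 <= X w) -> A X.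
Hypothesis ApB : forall X Y, A X -> Borel Y -> (forall w, 0 <= Y w) -> A (X \+ Y).
Hypothesis AmG_convex : forall X Y (l : R), AmG A G X -> AmG A G Y ->
  0 <= l <= 1 -> AmG A G (fun w => l * X w + (1 - l) * Y w).
Hypothesis tail : forall n : nat, exists2 z : R, 0 <= z &
  GmA A G (fun w => n.+1%:R * Num.max (Z w - z) 0 - n.+1%:R^-1).

(** * The metric on [Om] and the weighted function spaces *)

Definition omega_dist (x y : OmT x0) : R := `|set_val x - set_val y|.

Lemma omega_dist_metrizes : metrizes omega_dist.
Proof.
rewrite /omega_dist; split=> [x|x y|x y z|x B].
- by rewrite subrr normr0.
- exact: distrC.
- by apply: le_trans (ler_normD _ _); rewrite addrA subrK.
- split; last first.
    move=> [e e0 /filterS]; apply.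
    have /cvgr_dist_lt := @initial_continuous _ _ (set_val : set_type Om -> _) x.
    by apply.
  rewrite nbhsE => -[C [[V oV <-] Vx] VB].
  have /nbhs_normP[e /= e0 eV] : nbhs (set_val x) V by apply: open_nbhs_nbhs; split.
  by exists e => // y xy; apply: VB; exact: eV.
Qed.

Lemma Z_gt0 w : 0 < Z w. Proof. exact: lt_le_trans (Z1 w). Qed.

Lemma cont_dominated_Z : cont_dominated Z Z.
Proof. by split=> //; exists 1 => w; rewrite mul1r ger0_norm// ltW// Z_gt0. Qed.

Lemma borel_cst c : @Borel _ _ _ _ x0 (fun=> c).
Proof. exact: measurable_cst. Qed.

Lemma borel_lin (a : R) (X Y : OmT x0 -> R) :
  Borel X -> Borel Y -> Borel (fun w => a * X w + Y w).
Proof.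
move=> bX bY; apply: measurable_funD => //.
by apply: measurable_funM => //; exact: measurable_cst.
Qed.

Lemma borel_sub (X Y : OmT x0 -> R) :
  Borel X -> Borel Y -> Borel (fun w => X w - Y w).
Proof. by move=> bX bY; exact: measurable_funB. Qed.

Lemma borel_cont (X : OmT x0 -> R) : continuous X -> Borel X.
Proof. exact: continuous_borel. Qed.

Lemma BZP (X : OmT x0 -> R) :
  BZ Z X <-> Borel X /\ exists c, forall w, `|X w| <= c * Z w.
Proof.
have e c w : (`|X w / Z w| <= c) = (`|X w| <= c * Z w).
  by rewrite normrM normfV (gtr0_norm (Z_gt0 w)) ler_pdivrMr// Z_gt0.
split=> -[bX [c h]]; split=> //; exists c => w; first by rewrite -e.
by rewrite e.
Qed.

Lemma CZP (X : OmT x0 -> R) : CZ Z X <-> cont_dominated Z X.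
Proof.
split=> [[/BZP[_ ?] ?]|[cX hX]]; first by split.
by split=> //; apply/BZP; split=> //; exact: borel_cont.
Qed.

Lemma CZ_UZ (X : OmT x0 -> R) : CZ Z X -> UZ Z X.
Proof.
move=> [BX cX]; split=> // w a Xa.
exact: (@cvgr_lt _ _ _ _ X (X w) (cX w) a Xa).
Qed.

Lemma BZ_lin (a : R) (X Y : OmT x0 -> R) :
  BZ Z X -> BZ Z Y -> BZ Z (fun w => a * X w + Y w).
Proof.
move=> /BZP[bX [b hX]] /BZP[bY [c hY]]; apply/BZP; split; first exact: borel_lin.
exists (`|a| * b + c) => w; apply: le_trans (ler_normD _ _) _.
by rewrite mulrDl lerD// normrM -mulrA ler_wpM2l.
Qed.

Lemma BZ_cst c : BZ Z (fun=> c).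
Proof. by have /CZP[] := cont_dominated_cst Z1 c. Qed.

Lemma BZ_add (X Y : OmT x0 -> R) : BZ Z X -> BZ Z Y -> BZ Z (fun w => X w + Y w).
Proof.
move=> bX bY; have := BZ_lin 1 bX bY.
by congr BZ; apply/funext => w; rewrite mul1r.
Qed.

Lemma BZ_scale a (X : OmT x0 -> R) : BZ Z X -> BZ Z (fun w => a * X w).
Proof.
move=> bX; have := BZ_lin a bX (BZ_cst 0).
by congr BZ; apply/funext => w; rewrite addr0.
Qed.

(** * Stability of [A - G] and existence of superhedges *)

Lemma AmG_borel X : AmG A G X -> Borel X.
Proof. by move=> [a [g [Aa [Gg ->]]]]; apply: borel_sub; [exact: AB | exact: GB]. Qed.

(** The nonnegative Borel excess of [Y] over [X] is absorbed by the component in [A]. *)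
Lemma AmG_up (X Y : OmT x0 -> R) :
  AmG A G X -> Borel Y -> (forall w, X w <= Y w) -> AmG A G Y.
Proof.
move=> AX bY XY; have bX := AmG_borel AX.
case: AX XY bX => a [g [Aa [Gg ->]]] XY bX.
exists (a \+ (fun w => Y w - (a w - g w))), g; split.
  by apply: ApB => // [|w]; [exact: borel_sub | rewrite subr_ge0; exact: XY].
by split=> //; apply/funext => w /=; ring.
Qed.

Lemma AmG_ge0 (X : OmT x0 -> R) : Borel X -> (forall w, 0 <= X w) -> AmG A G X.
Proof.
move=> bX X0; exists X, (fun=> 0); split; first exact: BpA.
by split=> //; apply/funext => w /=; rewrite subr0.
Qed.

Lemma GmA_AmGN (X : OmT x0 -> R) : GmA A G X <-> AmG A G (fun w => - X w).
Proof.
split=> [[g [a [Gg [Aa ->]]]]|[a [g [Aa [Gg h]]]]].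
  by exists a, g; split=> //; split=> //; apply/funext => w /=; rewrite opprB.
exists g, a; split=> //; split=> //; apply/funext => w /=.
by have := congr1 (fun f => - f w) h; rewrite /= opprK opprB.
Qed.

Lemma GmA_down (X Y : OmT x0 -> R) :
  GmA A G X -> Borel Y -> (forall w, Y w <= X w) -> GmA A G Y.
Proof.
move=> /GmA_AmGN AX bY YX; apply/GmA_AmGN; apply: (AmG_up AX).
  have := borel_lin (-1) bY (borel_cst 0).
  by congr Borel; apply/funext => w; rewrite addr0 mulN1r.
by move=> w; rewrite lerN2.
Qed.

Lemma tail_superhedge n : exists2 z : R, 0 <= z &
  AmG A G (fun w => n.+1%:R^-1 - n.+1%:R * Num.max (Z w - z) 0).
Proof.
have [z z0 /GmA_AmGN h] := tail n; exists z => //; move: h.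
by congr AmG; apply/funext => w; rewrite opprB.
Qed.

(** For [n >= c] one has [X <= c Z <= n (Z - z)^+ + n z], and the tail condition covers
    [n (Z - z)^+] at the price [1 / n]. *)
Lemma BZ_superhedge (X : OmT x0 -> R) : BZ Z X ->
  exists m : R, AmG A G (fun w => m - X w).
Proof.
move=> /BZP[bX [c hX]].
have [z z0 h] := tail_superhedge (Num.bound `|c|).
set n := _.+1%:R in h.
have cn : c <= n.
  apply: le_trans (ler_norm c) _; apply: (@le_trans _ _ (Num.bound `|c|)%:R).
    by apply/ltW/archi_boundP.
  by rewrite ler_nat.
have n0 : 0 <= n by rewrite ler0n.
exists (n * z + n^-1); apply: (AmG_up h).
  by apply: borel_sub => //; exact: borel_cst.
move=> w; have := hX w; rewrite ler_norml => /andP[_ hXw].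
have hM : Z w - z <= Num.max (Z w - z) 0 by rewrite le_max lexx.
have : c * Z w <= n * Z w by rewrite ler_wpM2r// ltW// Z_gt0.
have : n * Z w <= n * (Num.max (Z w - z) 0 + z) by rewrite ler_wpM2l// -lerBlDr.
by move: (n^-1) => r; clearbody n; lra.
Qed.

(** Real-valued form of [phi]. The default value of [inf] is avoided on [BZ], where the set is
    nonempty and, without arbitrage, bounded below. *)
Definition price (X : OmT x0 -> R) : R := inf [set m | AmG A G (fun w => m - X w)].

(** * Expectations under measures that integrate [Z] *)

Section MeasuresInPZ.
Variable P : probability (OmM x0) R.
Hypothesis PZP : PZ Z P.

Lemma PZ_integrable X : BZ Z X -> P.-integrable setT (EFin \o X : OmM x0 -> \bar R).
Proof.
move=> /BZP[bX [c hX]].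
have iZ : P.-integrable setT (EFin \o Z : OmM x0 -> \bar R).
  apply/integrableP; split; first by apply/measurable_EFinP; exact: borel_cont.
  apply: le_lt_trans PZP; apply: ge0_le_integral => //.
  - by apply/measurable_EFinP; apply: measurableT_comp => //; exact: borel_cont.
  - by apply/measurable_EFinP; exact: borel_cont.
  - by move=> w _ /=; rewrite lee_fin ger0_norm// ltW// Z_gt0.
apply: (le_integrable measurableT _ _ (integrableZl measurableT c iZ)).
  exact/measurable_EFinP.
move=> w _ /=; rewrite lee_fin; apply: le_trans (hX w) _; exact: ler_norm.
Qed.

Lemma Ex_fin_num X : BZ Z X -> Ex P X \is a fin_num.
Proof. by move=> bX; apply: integrable_fin_num => //; exact: PZ_integrable. Qed.

Lemma Ex_mono X Y : BZ Z X -> BZ Z Y -> (forall w, X w <= Y w) ->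
  (Ex P X <= Ex P Y)%E.
Proof.
move=> bX bY XY; apply: le_integral => //; [exact: PZ_integrable..|].
by move=> w _; rewrite lee_fin.
Qed.

(** The quotient [X / Z] is bounded and upper semicontinuous, hence a decreasing limit of bounded
    continuous [u n]. The functions [Z * u n] lie in [CZ] above [X], and dominated convergence with
    bound [c * Z] applies. *)
Lemma Ex_usc_approx X e : UZ Z X -> 0 < e -> exists2 W, CZ Z W /\
  (forall w, X w <= W w) & (Ex P W <= Ex P X + e%:E)%E.
Proof.
move=> [bX uX] e0; have /BZP[mX [c hX]] := bX.
pose v w := X w / Z w.
have vb w : - c <= v w <= c.
  by rewrite -ler_norml /v normrM normfV (gtr0_norm (Z_gt0 w)) ler_pdivrMr// Z_gt0.
have [|u [uc ub ud ul]] := usc_approx omega_dist_metrizes vb.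
  move=> w r; rewrite /v ltr_pdivrMr ?Z_gt0// => Xr.
  (* The midpoint separates the two conditions near [w]: [X y < s] by semicontinuity of [X], and
     [s < r * Z y] by continuity of [Z]. *)
  pose s := (X w + r * Z w) / 2.
  have s1 : X w < s by rewrite /s; lra.
  have s2 : s < r * Z w by rewrite /s; lra.
  have [rZ _] : cont_dominated Z (fun y => r * Z y).
    exact: cont_dominated_scale cont_dominated_Z.
  near=> y; rewrite ltr_pdivrMr ?Z_gt0//; apply: (@lt_trans _ _ s); near: y.
    exact: uX.
  exact: (@cvgr_gt _ _ _ _ _ _ (rZ w) s s2).
pose W n w := Z w * u n w.
have uCZ w n : `|u n w| <= c.
  by rewrite ler_norml; have := ub n w; have := vb w; lra.
have CW n : CZ Z (W n).
  apply/CZP; apply: (cont_dominated_mulr _ (uc n) (fun w => uCZ w n)).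
  exact: cont_dominated_Z.
have XW n w : X w <= W n w.
  by have /andP[+ _] := ub n w; rewrite /v ler_pdivrMr ?Z_gt0// mulrC.
have bcZ : BZ Z (fun w => c * Z w).
  by apply: BZ_scale; have /CZP[] := cont_dominated_Z.
have [|||||_ _ h] := @dominated_convergence _ (OmM x0) R P setT measurableT
  (fun n => EFin \o W n) (EFin \o X) (EFin \o (fun w => c * Z w)).
- by move=> n; apply/measurable_EFinP; case: (CW n) => -[].
- exact/measurable_EFinP.
- apply: aeW => w _; apply: cvg_EFin; first exact: nearW.
  apply/cvgrPdist_lt => r r0.
  have [n un] := ul w (r / Z w) (divr_gt0 r0 (Z_gt0 w)).
  near=> m; have nm : (n <= m)%N by near: m; exact: nbhs_infty_ge.
  have := XW m w; rewrite /= -subr_ge0 distrC => Wm; rewrite ger0_norm// ltrBlDl.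
  have : Z w * u m w < Z w * (v w + r / Z w).
    by rewrite ltr_pM2l ?Z_gt0//; apply: le_lt_trans un; exact: ud.
  by rewrite mulrDr /v !(mulrC (Z w)) !divfK ?gt_eqF ?Z_gt0// mulrC.
- exact: PZ_integrable.
- apply: aeW => w n _ /=; rewrite lee_fin normrM ger0_norm; last exact/ltW/Z_gt0.
  by rewrite mulrC ler_wpM2r// ltW// Z_gt0.
have /filter_ex[n hn] : \forall n \near \oo, (Ex P (W n) < Ex P X + e%:E)%E.
  apply: (h [set y | (y < Ex P X + e%:E)%E]).
  apply: open_nbhs_nbhs; split; first exact: open_ereal_lt_ereal.
  by rewrite /= lteDl ?lte_fin//; exact: Ex_fin_num.
by exists (W n) => //; exact: ltW.
Unshelve. all: by end_near. Qed.

End MeasuresInPZ.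

(** * The price when [A - G] contains no negative constant *)

Section NoArbitrage.
Hypothesis NA : forall m : R, AmG A G (fun=> m) -> 0 <= m.

(** The average of [m - X] and [m' + X] is the constant [(m + m') / 2], which lies in [A - G] by
    convexity. Any superhedge of [- X] thus bounds the superhedges of [X] from below. *)
Lemma superhedge_pair_ge0 (X : OmT x0 -> R) m m' :
  AmG A G (fun w => m - X w) -> AmG A G (fun w => m' + X w) -> 0 <= m + m'.
Proof.
move=> h h'; have l01 : 0 <= (2^-1 : R) <= 1 by lra.
suff : 0 <= 2^-1 * m + (1 - 2^-1) * m' by lra.
apply: NA; have := AmG_convex h h' l01; congr AmG; apply/funext => w.
by field.
Qed.

Lemma superhedge_lbound (X : OmT x0 -> R) : BZ Z X ->
  has_lbound [set m | AmG A G (fun w => m - X w)].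
Proof.
move=> bX; have [m' h'] := BZ_superhedge (BZ_scale (-1) bX).
exists (- m') => m h; rewrite -subr_ge0 opprK; apply: (superhedge_pair_ge0 h).
by move: h'; congr AmG; apply/funext => w; rewrite mulN1r opprK.
Qed.

Lemma phi_price X : BZ Z X -> phi A G X = (price X)%:E.
Proof.
by move=> bX; apply: ereal_inf_EFin; [exact: superhedge_lbound | exact: BZ_superhedge].
Qed.

Lemma price_le X m : BZ Z X -> AmG A G (fun w => m - X w) -> price X <= m.
Proof. by move=> bX h; apply: ge_inf => //; exact: superhedge_lbound. Qed.

Lemma price_approx X e : BZ Z X -> 0 < e ->
  exists2 m, AmG A G (fun w => m - X w) & m < price X + e.
Proof.
move=> bX e0; apply: inf_adherent => //; split; first exact: BZ_superhedge.
exact: superhedge_lbound.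
Qed.

Lemma price_mono X Y : BZ Z X -> BZ Z Y -> (forall w, X w <= Y w) ->
  price X <= price Y.
Proof.
move=> bX bY XY; apply/ler_addgt0Pr => e e0.
have [m hm mY] := price_approx bY e0.
apply: le_trans (ltW mY); apply: price_le => //; apply: (AmG_up hm).
  by apply: borel_sub; [exact: borel_cst | case: bX].
by move=> w; rewrite lerB.
Qed.

Lemma price_translate X c : BZ Z X -> price (fun w => X w + c) <= price X + c.
Proof.
move=> bX; apply/ler_addgt0Pr => e e0; have [m hm mX] := price_approx bX e0.
have : price (fun w => X w + c) <= m + c.
  apply: price_le; first by apply: BZ_add => //; exact: BZ_cst.
  by move: hm; congr AmG; apply/funext => w; ring.
lra.
Qed.

Lemma price_convex X Y t : BZ Z X -> BZ Z Y -> 0 <= t <= 1 ->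
  price (fun w => t * X w + (1 - t) * Y w) <= t * price X + (1 - t) * price Y.
Proof.
move=> bX bY t01; apply/ler_addgt0Pr => e e0.
have [m hm mX] := price_approx bX e0.
have [m' hm' mY] := price_approx bY e0.
have : price (fun w => t * X w + (1 - t) * Y w) <= t * m + (1 - t) * m'.
  apply: price_le; first by apply: BZ_lin => //; exact: BZ_scale.
  by have := AmG_convex hm hm' t01; congr AmG; apply/funext => w; ring.
nra.
Qed.

Lemma price0 : price (fun=> 0) = 0.
Proof.
have b0 := BZ_cst 0.
apply/eqP; rewrite eq_le; apply/andP; split.
  by apply: price_le => //; apply: AmG_ge0 => [|w]; [exact: borel_cst | rewrite subrr].
apply/ler_addgt0Pr => e e0; have [m hm mX] := price_approx b0 e0.
apply: le_trans (ltW mX); apply: NA; move: hm.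
by congr AmG; apply/funext => w; rewrite subr0.
Qed.

(** * Linear subgradients of the price as expectations *)

Section Subgradient.
Variables (X : OmT x0 -> R) (l : (OmT x0 -> R) -> R).
Hypothesis bX : BZ Z X.
Hypothesis l_lin : forall a U V, BZ Z U -> BZ Z V ->
  l (fun w => a * U w + V w) = a * l U + l V.
Hypothesis l_sub : forall Y, BZ Z Y -> l Y <= price (fun w => X w + Y w) - price X.

Lemma subgradient0 : l (fun=> 0) = 0.
Proof.
have := l_lin 1 (BZ_cst 0) (BZ_cst 0).
have -> : (fun _ : OmT x0 => 1 * 0 + 0) = (fun=> 0) :> (OmT x0 -> R).
  by apply/funext => w; rewrite mulr0 addr0.
lra.
Qed.

Lemma subgradient_scale a U : BZ Z U -> l (fun w => a * U w) = a * l U.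
Proof.
move=> bU; have := l_lin a bU (BZ_cst 0); rewrite subgradient0 addr0 => <-.
by congr l; apply/funext => w; rewrite addr0.
Qed.

(** Monotonicity of the price, tested in the direction [- U]. *)
Lemma subgradient_pos U : BZ Z U -> (forall w, 0 <= U w) -> 0 <= l U.
Proof.
move=> bU U0; have bN := BZ_scale (-1) bU.
have := l_sub bN; rewrite subgradient_scale//.
have : price (fun w => X w + -1 * U w) <= price X.
  apply: price_mono => //; first exact: BZ_add.
  by move=> w; rewrite mulN1r gerBl.
lra.
Qed.

Lemma subgradient_mono U V : BZ Z U -> BZ Z V -> (forall w, U w <= V w) -> l U <= l V.
Proof.
move=> bU bV UV.
have : 0 <= l (fun w => -1 * U w + V w).
  by apply: subgradient_pos => [|w]; [exact: BZ_lin | rewrite mulN1r addrC subr_ge0].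
by rewrite l_lin//; lra.
Qed.

(** Translation bounds [l] by [c] on each constant [c]; the values [c = 1] and [c = -1] give both
    inequalities. *)
Lemma subgradient1 : l (fun=> 1) = 1.
Proof.
have h c : l (fun=> c) <= c.
  have := l_sub (BZ_cst c); have := price_translate c bX; lra.
have : l (fun=> -1) = -1 * l (fun=> 1).
  rewrite -subgradient_scale; last exact: BZ_cst.
  by congr l; apply/funext => w; rewrite mulN1r.
have := h 1; have := h (-1); lra.
Qed.

(* The slope of [t |-> price (X + t Y)] dominates [l Y]; for [Y = (Z - z)^+]
   convexity and the tail condition keep it bounded for [t] up to [n / 2]. *)
Lemma subgradient_tail : exists2 K, 0 <= K & forall n : nat, exists2 z, 0 <= z &
  l (fun w => Num.max (Z w - z) 0) <= K / n.+1%:R.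
Proof.
(* With [N = n + 1], the midpoint of [2 X] and [N Y] is [X + (N / 2) Y], so [N * l Y <= price (2 X)
   + 1 / N - 2 price X <= K]. *)
pose K := `|price (fun w => 2 * X w)| + 1 + 2 * `|price X|.
exists K; first by rewrite /K !addr_ge0// mulr_ge0.
move=> n; have [z z0 hz] := tail_superhedge n; exists z => //.
set N := n.+1%:R in hz *.
have N0 : 0 < N by rewrite ltr0n.
have N1 : N^-1 <= 1 by rewrite invf_le1// ler1n.
pose Y w := Num.max (Z w - z) 0.
have bY : BZ Z Y.
  have /CZP[] // : cont_dominated Z Y.
  apply: cont_dominated_max => //; last exact: cont_dominated_cst.
  apply: cont_dominated_sub => //; last exact: cont_dominated_cst.
  exact: cont_dominated_Z.
have bNY : BZ Z (fun w => N * Y w) by exact: BZ_scale.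
have b2X : BZ Z (fun w => 2 * X w) by exact: BZ_scale.
have hN : price (fun w => N * Y w) <= N^-1 by exact: price_le.
have l01 : 0 <= (2^-1 : R) <= 1 by lra.
have h2 := price_convex b2X bNY l01.
have e2 : (fun w => 2^-1 * (2 * X w) + (1 - 2^-1) * (N * Y w)) =
    (fun w => X w + N / 2 * Y w) by apply/funext => w; field.
rewrite e2 in h2.
have h1 := l_sub (BZ_scale (N / 2) bY); rewrite subgradient_scale// in h1.
rewrite ler_pdivlMr// -/Y /K.
move: N0 N1 h1 h2 hN; clearbody N; move: (N^-1) => r.
move: (price (fun w => X w + N / 2 * Y w)) (price (fun w => N * Y w)).
move: (price X) (price (fun w => 2 * X w)) (l Y) => a b t u v.
have := ler_norm b; have := ler_norm (- a); rewrite normrN; lra.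
Qed.

(** Where [Z <= 2 z], Dini's argument makes [f N] at most [e / 4]. Elsewhere [Z < 2 (Z - z)], so
    [f N <= f 0 <= c Z] is at most [2 c (Z - z)^+], whose value under [l] is small by
    [subgradient_tail]. *)
Lemma subgradient_daniell (f : nat -> OmT x0 -> R) :
  (forall n, cont_dominated Z (f n)) -> (forall n w, 0 <= f n w) ->
  (forall w, {homo f^~ w : m n / (m <= n)%N >-> n <= m}) ->
  (forall w e, 0 < e -> exists n, f n w < e) ->
  forall e, 0 < e -> exists n, l (f n) < e.
Proof.
move=> Cf f0 fd flim e e0.
have [K K0 hK] := subgradient_tail.
have [_ [c fc]] := Cf 0%N.
have c0 : 0 <= c.
  have := fc x0; have := normr_ge0 (f 0%N x0); have := Z_gt0 x0; nra.
(* Chosen so that the tail term [2 c K / (n + 1)] is at most [e / 4]; the two contributions then add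
   up to at most [e / 2]. *)
pose n := Num.bound (8 * c * K / e).
have n_large : 2 * c * (K / n.+1%:R) <= e / 4.
  have : 8 * c * K / e <= n.+1%:R.
    apply: (@le_trans _ _ n%:R); last by rewrite ler_nat.
    by apply/ltW/archi_boundP; rewrite divr_ge0 ?mulr_ge0// ltW.
  rewrite ler_pdivrMr// => h.
  have n0 : 0 < n.+1%:R :> R by rewrite ltr0n.
  rewrite mulrA ler_pdivrMr//; lra.
have [z z0 hz] := hK n.
have e40 : 0 < e / 4 by rewrite divr_gt0.
have [N hN] : exists N, forall w, Z w <= 2 * z -> f N w <= e / 4.
  have z20 : 0 <= 2 * z by lra.
  (* At each point some [f m] is below [e / 4] on a neighbourhood and, by monotonicity, so are all
     later ones; compactness makes the index uniform. *)
  have /compact_near_coveringP cpt := Zcpt z20.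
  have [|N hN] := filter_ex (cpt nat \oo (fun m w => f m w <= e / 4) _ _).
    move=> w _; have [m fm] := flim w _ e40.
    have near_w : \forall y \near w, f m y < e / 4.
      exact: (@cvgr_lt _ _ _ _ (f m) _ ((Cf m).1 w) _ fm).
    exists ([set y | f m y < e / 4], [set k | (m <= k)%N]).
      by split => //=; exact: nbhs_infty_ge.
    by move=> [y k] /= [fy mk]; exact: le_trans (fd y _ _ mk) (ltW fy).
  by exists N.
exists N.
pose Y w := Num.max (Z w - z) 0.
have Y0 w : 0 <= Y w by rewrite le_max lexx orbT.
have CY : cont_dominated Z Y.
  apply: cont_dominated_max => //; last exact: cont_dominated_cst.
  apply: cont_dominated_sub => //; last exact: cont_dominated_cst.
  exact: cont_dominated_Z.
have bY : BZ Z Y by have /CZP[] := CY.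
have bf : BZ Z (f N) by have /CZP[] := Cf N.
have be := BZ_cst (e / 4).
apply: (@le_lt_trans _ _ (l (fun w => (2 * c) * Y w + e / 4))).
  apply: subgradient_mono => //; first exact: BZ_lin.
  move=> w; have [Zw|Zw] := leP (Z w) (2 * z).
    have := hN w Zw; have := Y0 w; nra.
  have YZ : Z w - z <= Y w by rewrite /Y le_max lexx.
  have := le_trans (ler_norm _) (fc w); have := fd w _ _ (leq0n N).
  nra.
rewrite l_lin//.
have -> : l (fun=> e / 4) = e / 4.
  have := subgradient_scale (e / 4) (BZ_cst 1); rewrite subgradient1 mulr1 => {2}<-.
  by congr l; apply/funext => w; rewrite mulr1.
have : 2 * c * l Y <= 2 * c * (K / n.+1%:R) by rewrite ler_wpM2l// mulr_ge0.
by move=> /le_trans /(_ n_large); lra.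
Qed.

Lemma subgradient_measure : exists2 P : probability (OmM x0) R, PZ Z P &
  forall Y, CZ Z Y -> Ex P Y = (l Y)%:E.
Proof.
have CB Y : cont_dominated Z Y -> BZ Z Y by move=> /CZP[].
have ll a f g : cont_dominated Z f -> cont_dominated Z g ->
    l (fun w => a * f w + g w) = a * l f + l g.
  by move=> /CB bf /CB bg; exact: l_lin.
have lp f : cont_dominated Z f -> (forall w, 0 <= f w) -> 0 <= l f.
  by move=> /CB bf; exact: subgradient_pos.
pose P := daniell_probability omega_dist_metrizes Z1 ll lp subgradient1
  subgradient_daniell.
have hP Y : CZ Z Y -> Ex P Y = (l Y)%:E.
  by move=> /CZP CY; exact: daniell_integral.
exists P => //; rewrite /PZ; have := hP Z; rewrite /Ex => ->; first exact: ltry.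
by apply/CZP; exact: cont_dominated_Z.
Qed.

End Subgradient.

(** * Existence of subgradients and the dual representation *)

Lemma price_subgradient X : BZ Z X -> exists l : (OmT x0 -> R) -> R,
  (forall a U V, BZ Z U -> BZ Z V -> l (fun w => a * U w + V w) = a * l U + l V) /\
  (forall Y, BZ Z Y -> l Y <= price (fun w => X w + Y w) - price X).
Proof.
move=> bX.
have shift_combination (a b c s : R) :
    s * (a + b) + (1 - s) * (a + c) = a + (s * b + (1 - s) * c) by ring.
(* The increment of the price at [X] is convex and vanishes at 0 but need not be positively
   homogeneous, hence the extension theorem for convex bounds. Writing [R^o] makes the function
   space a module over [R]. *)
apply: (@hahn_banach R (OmT x0 -> R^o) (BZ Z)
  (fun Y => price (fun w => X w + Y w) - price X)).
- exact: BZ_cst.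
- exact: BZ_lin.
- move=> U V t bU bV t01.
  have := price_convex (BZ_add bX bU) (BZ_add bX bV) t01.
  have -> : (fun w => t * (X w + U w) + (1 - t) * (X w + V w)) =
      (fun w => X w + (t *: U + (1 - t) *: V) w).
    by apply/funext => w; exact: shift_combination.
  lra.
- rewrite (_ : (fun w => _) = X) ?subrr//.
  by apply/funext => w; exact: addr0.
Qed.

(** Continuous approximation from above gives [l X <= E^P X]. The subgradient inequality in the
    direction [Y - X] then yields [E^P Y - phi Y <= l X - phi X <= E^P X - phi X] for every [Y] in
    [CZ], which bounds [phistar P]. *)
Lemma dual_attained X : UZ Z X ->
  exists2 P : probability (OmM x0) R, PZ Z P & (phi A G X <= Ex P X - phistar Z A G P)%E.
Proof.
move=> uX; have [bX _] := uX.
have [l [l_lin l_sub]] := price_subgradient bX.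
have [P PZP hP] := subgradient_measure bX l_lin l_sub.
exists P => //.
have lX : ((l X)%:E <= Ex P X)%E.
  apply/lee_addgt0Pr => e e0.
  have [W [CW XW] hW] := Ex_usc_approx PZP uX e0.
  apply: le_trans hW; rewrite hP// lee_fin.
  by apply: (subgradient_mono bX l_lin l_sub) => //; case: CW.
have /fineK eX := Ex_fin_num PZP bX.
move: lX; rewrite -eX lee_fin phi_price//; set r := fine _ => lX.
have hs : (phistar Z A G P <= (r - price X)%:E)%E.
  apply: ge_ereal_sup => _ [Y CY <-]; have [bY _] := CY.
  rewrite hP// phi_price// -EFinB lee_fin.
  have := l_sub _ (BZ_lin (-1) bX bY); rewrite l_lin//.
  rewrite (_ : (fun w => X w + _) = Y); last by apply/funext => w; ring.
  lra.
apply: le_trans (leeB (lexx r%:E) hs).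
by rewrite -EFinB lee_fin; lra.
Qed.

Lemma dual_le_cont X (P : probability (OmM x0) R) : CZ Z X -> PZ Z P ->
  (Ex P X - phistar Z A G P <= phi A G X)%E.
Proof.
move=> CX PZP; have [bX _] := CX.
have : (Ex P X - phi A G X <= phistar Z A G P)%E.
  by apply: ereal_sup_ubound; exists X.
have /fineK <- := Ex_fin_num PZP bX; set r := fine _.
rewrite phi_price// -EFinB => h; apply: (le_trans (leeB (lexx r%:E) h)).
by rewrite -EFinB lee_fin; lra.
Qed.

Lemma dual_repI X : UZ Z X ->
  (forall P : probability (OmM x0) R, PZ Z P ->
    (Ex P X - phistar Z A G P <= phi A G X)%E) ->
  dual_rep Z A G X.
Proof.
move=> uX hle; have [P PZP hP] := dual_attained uX.
have eP : phi A G X = (Ex P X - phistar Z A G P)%E.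
  by apply/eqP; rewrite eq_le hP hle.
split; last by exists P.
apply/eqP; rewrite eq_le; apply/andP; split.
  by apply: le_ereal_sup_tmp; exists (Ex P X - phistar Z A G P)%E; [exists P|].
by apply: ge_ereal_sup => _ [Q PZQ <-]; exact: hle.
Qed.

Lemma dual_rep_cont X : CZ Z X -> dual_rep Z A G X.
Proof. by move=> CX; apply: dual_repI => [|P]; [exact: CZ_UZ | exact: dual_le_cont]. Qed.

(** Each [Y] in [CZ] above [X] satisfies [E^P X - phistar P <= E^P Y - phistar P <= phi Y]; the
    infimum over [Y] is [phi X]. *)
Lemma dual_rep_usc X : UZ Z X ->
  phi A G X = ereal_inf [set phi A G Y | Y in [set Y | CZ Z Y /\ forall w, X w <= Y w]] ->
  dual_rep Z A G X.
Proof.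
move=> uX hU; have [bX _] := uX; apply: dual_repI => // P PZP.
rewrite hU; apply: le_ereal_inf_tmp => _ [Y [CY XY] <-].
apply: le_trans (dual_le_cont CY PZP); apply: leeB => //.
by apply: Ex_mono => //; case: CY.
Qed.

Lemma phi_fin_num X : BZ Z X -> phi A G X \is a fin_num.
Proof. by move=> bX; rewrite phi_price. Qed.

Lemma phi0 : phi A G (fun=> 0) = 0%E.
Proof. by rewrite phi_price ?price0//; exact: BZ_cst. Qed.

End NoArbitrage.

(** * Measures with nonpositive expectations on [G - A], and arbitrage *)

Lemma Ex_cst (P : probability (OmM x0) R) c : Ex P (fun=> c) = c%:E.
Proof.
rewrite /Ex integral_cst// -[RHS]mule1; congr (_ * _)%E.
exact: probability_setT.
Qed.

Lemma CZ_cst c : CZ Z (fun=> c).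
Proof. by apply/CZP; exact: cont_dominated_cst. Qed.

Lemma dual_rep_martingale (C : set (OmT x0 -> R)) : C (fun=> 0) ->
  phi A G (fun=> 0) = 0%E -> (forall X, C X -> dual_rep Z A G X) ->
  exists2 P, PZ Z P & forall X, C X -> GmA A G X -> (Ex P X <= 0)%E.
Proof.
move=> C0 p0 rep; have [_ [P PZP]] := rep _ C0.
rewrite p0 Ex_cst add0e => /esym/eqP; rewrite eqe_oppLR oppe0 => /eqP hs.
exists P => // X CX /GmA_AmGN hX; have [hsup _] := rep _ CX.
have phi_le0 : (phi A G X <= 0)%E.
  apply: ereal_inf_lbound; exists 0 => //=.
  by move: hX; congr AmG; apply/funext => w; rewrite sub0r.
apply: le_trans phi_le0; rewrite hsup; apply: le_ereal_sup_tmp.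
by exists (Ex P X - phistar Z A G P)%E; [exists P | rewrite hs sube0].
Qed.

Lemma martingale_no_arbitrage : (exists2 P, PZ Z P &
    forall X, CZ Z X -> GmA A G X -> (Ex P X <= 0)%E) ->
  forall m : R, AmG A G (fun=> m) -> 0 <= m.
Proof.
move=> [P PZP hP] m hm.
have h : GmA A G (fun=> - m).
  by apply/GmA_AmGN; move: hm; congr AmG; apply/funext => w; rewrite opprK.
by have := hP _ (CZ_cst _) h; rewrite Ex_cst lee_fin oppr_le0.
Qed.

(** Monotonicity of [A - G] reduces [X >= eps] to the constant [- eps]. *)
Lemma no_uniform_arbitrageP :
  ~ (exists X (eps : R), GmA A G X /\ 0 < eps /\ forall w, eps <= X w) <->
  (forall m : R, AmG A G (fun=> m) -> 0 <= m).
Proof.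
split=> [na m hm|na [X [e [/GmA_AmGN hX [e0 eX]]]]].
  rewrite leNgt; apply/negP => m0; apply: na; exists (fun=> - m), (- m).
  split; last by rewrite oppr_gt0.
  by apply/GmA_AmGN; move: hm; congr AmG; apply/funext => w; rewrite opprK.
have := na (- e) (AmG_up hX (borel_cst _) (fun w => _)).
by rewrite oppr_ge0 leNgt e0 => /(_ _)/negP; apply => // w; rewrite lerN2.
Qed.

Lemma usc_martingale_no_arbitrage : (exists2 P, PZ Z P &
    forall X, UZ Z X -> GmA A G X -> (Ex P X <= 0)%E) ->
  ~ (exists X, GmA A G X /\ forall w, 0 < X w).
Proof.
move=> [P PZP hP] [X [hX X0]].
have bX : Borel X.
  by case: hX => g [a [Gg [Aa ->]]]; apply: borel_sub; [exact: GB | exact: AB].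
(* These sets cover the whole space because [X > 0], so countable subadditivity gives one of them
   positive measure. *)
pose B n := [set w | n.+1%:R^-1 <= X w].
have mB n : measurable (B n : set (OmM x0)).
  rewrite (_ : B n = setT `&` X @^-1` `[n.+1%:R^-1, +oo[); last first.
    by rewrite setTI; apply/seteqP; split=> w /=; rewrite in_itv/= andbT.
  exact: bX.
have [n PB] : exists n, (0 < P (B n))%E.
  apply: contrapT => nP.
  have PB0 n : P (B n) = 0%E.
    apply/eqP; rewrite eq_le measure_ge0 andbT leNgt; apply/negP => h.
    by apply: nP; exists n.
  have : (P setT <= \sum_(0 <= n <oo) P (B n))%E.
    apply: measure_sigma_subadditive => // w _.
    exists (Num.bound (X w)^-1) => //; rewrite /B /= invf_ple ?posrE//.
    apply: (@le_trans _ _ (Num.bound (X w)^-1)%:R); last by rewrite ler_nat.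
    by apply/ltW/archi_boundP; rewrite invr_ge0 ltW.
  by rewrite eseries0// probability_setT lee_fin ler10.
set c := n.+1%:R^-1 : R in B mB PB.
have c0 : 0 < c by rewrite invr_gt0 ltr0n.
have PBfin : P (B n) \is a fin_num by exact: fin_num_measure.
have PB0 : 0 < fine (P (B n)) by rewrite -lte_fin fineK.
(* The error allowed is [P (B n)] itself: since [P (B n) <= P F + P (U \ F)], the strict bound on
   the last term forces [P F > 0]. *)
have [F [U [cF oU FB BU PUF]]] := borel_regularity omega_dist_metrizes P (mB n) PB0.
have mF : measurable (F : set (OmM x0)) by exact: borel_closed.
have mUF : measurable (U `\` F : set (OmM x0)).
  by apply: measurableD => //; exact: borel_open.
have PF : (0 < P F)%E.
  rewrite lt0e measure_ge0 andbT; apply/eqP => PF0.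
  have : (P (B n) <= P F + P (U `\` F))%E.
    apply: le_trans (measureU2 _ mF mUF); apply: le_measure; rewrite ?inE//.
      exact: measurableU.
    by move=> w /BU Uw; have [?|?] := pselect (F w); [left | right].
  by rewrite PF0 add0e leNgt -(fineK PBfin) PUF.
(* Upper semicontinuous because [F] is closed, and below [X] because [X >= c] on [F] and [X > 0]
   elsewhere; its expectation [c * P F] is positive. *)
pose Y w := c * \1_F w.
have Y0c w : 0 <= Y w <= c.
  by rewrite /Y indicE; case: (_ \in _); rewrite ?mulr1 ?mulr0 ?lexx ltW.
have bY : Borel Y.
  by apply: measurable_funM; [exact: measurable_cst | exact: measurable_indic].
have UY : UZ Z Y.
  split.
    apply/BZP; split=> //; exists c => w; have := Y0c w; have := Z1 w => ? ?.
    by rewrite ger0_norm; [nra | lra].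
  move=> w a; have [Fw|nFw] := pselect (F w) => Ya.
    near=> y; have := Y0c y; rewrite /Y indicE mem_set//= mulr1 in Ya *; lra.
  have a0 : 0 < a by move: Ya; rewrite /Y indicE memNset// mulr0.
  near=> y; suff nFy : ~ F y by rewrite /Y indicE memNset// mulr0.
  by near: y; apply: open_nbhs_nbhs; split => //; exact: closed_openC.
have GY : GmA A G Y.
  apply: (GmA_down hX) => // w; rewrite /Y indicE; have [Fw|nFw] := pselect (F w).
    by rewrite mem_set// mulr1; exact: FB.
  by rewrite memNset// mulr0 ltW.
have := hP _ UY GY; rewrite leNgt => /negP; apply.
rewrite /Ex (_ : (\int[P]_w (Y w)%:E = c%:E * P F)%E).
  by rewrite mule_gt0.
under eq_integral do rewrite EFinM.
rewrite ge0_integralZl//.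
- by rewrite integral_indic// setIT.
- by apply/measurable_EFinP; exact: measurable_indic.
- by rewrite lee_fin ltW.
Unshelve. all: by end_near. Qed.

End SuperhedgingDuality.

(** * Assembly of the equivalences *)

Theorem theorem2p1 (R : realType) (J T : nat) (hT : (0 < T)%N)
  (Om : set 'M[R]_(T, J.+1))
  (hOm : forall x, Om x -> forall t : 'I_T, 0 < x t ord0)
  (x0 : set_type Om)
  (Z : OmT x0 -> R)
  (hZcont : continuous Z)
  (hZ1 : forall w, 1 <= Z w)
  (hZcpt : forall z : R, 0 <= z -> compact [set w | Z w <= z])
  (G A : set (OmT x0 -> R))
  (hGB : forall X, G X -> Borel X)
  (hAB : forall X, A X -> Borel X)
  (hG0 : G (fun _ => 0))
  (hBpA : forall X, Borel X -> (forall w, 0 <= X w) -> A X)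
  (hApB : forall X Y, A X -> Borel Y -> (forall w, 0 <= Y w) -> A (X \+ Y))
  (hconv : forall X Y (l : R), AmG A G X -> AmG A G Y -> 0 <= l <= 1 ->
            AmG A G (fun w => l * X w + (1 - l) * Y w))
  (hC : forall n : nat, exists2 z : R, 0 <= z &
          GmA A G (fun w => n.+1%:R * Num.max (Z w - z) 0 - n.+1%:R^-1)) :
  let i_ := ~ exists X (eps : R), GmA A G X /\ 0 < eps /\ forall w, eps <= X w in
  let ii_ := exists2 P, PZ Z P &
               forall X, CZ Z X -> GmA A G X -> (Ex P X <= 0)%E in
  let iii_ := (forall X, BZ Z X -> phi A G X \is a fin_num) /\
              phi A G (fun _ => 0) = 0%E /\
              (forall X, CZ Z X -> dual_rep Z A G X) in
  let iv_ := ~ exists X, GmA A G X /\ forall w, 0 < X w in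
  let v_ := exists2 P, PZ Z P &
               forall X, UZ Z X -> GmA A G X -> (Ex P X <= 0)%E in
  let vi_ := (forall X, BZ Z X -> phi A G X \is a fin_num) /\
             phi A G (fun _ => 0) = 0%E /\
             (forall X, UZ Z X -> dual_rep Z A G X) in
  ((i_ <-> ii_) /\ (ii_ <-> iii_)) /\
  ((forall X, UZ Z X ->
      phi A G X = ereal_inf [set phi A G Y | Y in [set Y | CZ Z Y /\ forall w, X w <= Y w]]) ->
   (iii_ <-> iv_) /\ (iv_ <-> v_) /\ (v_ <-> vi_)).

Proof.
have NAP := @no_uniform_arbitrageP _ _ _ _ _ G A hGB hAB hApB.
have C0 : CZ Z (fun=> 0) by exact: CZ_cst.
have U0 := CZ_UZ C0.
(* [NA] is the hub: it is equivalent to (i), follows from (ii), and implies (iii), which in turn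
   gives (ii). *)
pose NA := forall m : R, AmG A G (fun=> m) -> 0 <= m.
move=> i_ ii_ iii_ iv_ v_ vi_.
have i_NA : i_ <-> NA := NAP.
have ii_NA : ii_ -> NA by exact: martingale_no_arbitrage.
have NA_iii : NA -> iii_.
  move=> na; split; first by move=> X bX; exact: phi_fin_num.
  by split; [exact: phi0 | move=> X CX; exact: dual_rep_cont].
have iii_ii : iii_ -> ii_ by move=> [_ [p0 rep]]; exact: dual_rep_martingale.
split; first by tauto.
move=> hU.
(* Under (U), the cycle runs from [NA] through (vi), (v), (iv) and (i) back to [NA]. *)
have NA_vi : NA -> vi_.
  move=> na; split; first by move=> X bX; exact: phi_fin_num.
  by split; [exact: phi0 | move=> X UX; apply: dual_rep_usc => //; exact: hU].
have vi_v : vi_ -> v_ by move=> [_ [p0 rep]]; exact: dual_rep_martingale.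
have v_iv : v_ -> iv_ by exact: usc_martingale_no_arbitrage.
have iv_i : iv_ -> i_.
  move=> niv [X [e [GX [e0 eX]]]]; apply: niv; exists X; split=> // w.
  exact: lt_le_trans (eX w).
tauto.
Qed.
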